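(* The expectation of the principal eigenvalue $\mu_N(t)$ satisfies, for $t\in[0,T]$, $$\mathbb{E}\{\mu_N(t)\}=Np(t)+(1-p(t))+\frac{\overline{\mathcal{G}}_N(t)}{N},$$ for some $\overline{\mathcal{G}}_N(t)$ such that $\limsup_{N\to\infty}\sup_{t\in[0,T]}|\overline{\mathcal{G}}_N(t)|$ is finite.
   Context: Fix $T>0$, $p(0)\in(0,1)$, $\lambda_{\mathrm{on}}>0$ and $\lambda_{\mathrm{off}}>0$, all independent of $N$. For each $N\in\mathbb{N}$ consider the dynamic Erdős–Rényi random graph on $N$ vertices (self-loops allowed) with symmetric adjacency matrix process $A_N(t)=(a_{i,j}(t))_{i,j=1}^N$, $t\in[0,T]$, where $a_{i,j}(t)=a_{j,i}(t)\in\{0,1\}$, and the processes $(a_{i,j}(t))_{t\in[0,T]}$ with $1\leqslant i\leqslant j\leqslant N$ are independent and identically distributed càdlàg processes: $a_{i,j}(0)=1$ with probability $p(0)$ and $a_{i,j}(0)=0$ with probability $1-p(0)$; afterwards the process alternates between the values 1 and 0, each sojourn at 1 being exponentially distributed with parameter $\lambda_{\mathrm{on}}$ and each sojourn at 0 being exponentially distributed with parameter $\lambda_{\mathrm{off}}$, all sojourn times and the initial state being independent (so $a_{i,j}$ is a two-state continuous-time Markov chain). $p(t):=\mathbb{P}\{a_{i,j}(t)=1\}$; explicitly $p(t)=\varrho+\big((1-\varrho)p(0)-\varrho(1-p(0))\big)e^{-(\lambda_{\mathrm{on}}+\lambda_{\mathrm{off}})t}$ with $\varrho:=\lambda_{\mathrm{off}}/(\lambda_{\mathrm{on}}+\lambda_{\mathrm{off}})$.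 $\mu_N(t)$ denotes the principal (largest) eigenvalue of $A_N(t)$. Here $\overline{\mathcal{G}}_N(t)$ is a deterministic function of $t$ and $N$. *)

(* Defs.v *)
From HB Require Import structures.
From mathcomp Require Import all_boot all_order all_algebra finmap.
From mathcomp Require Import all_classical all_reals all_analysis.

Set Implicit Arguments.
Unset Strict Implicit.
Unset Printing Implicit Defensive.

Import Order.TTheory GRing.Theory Num.Theory.
Import numFieldNormedType.Exports.

Local Open Scope classical_set_scope.
Local Open Scope ring_scope.

(* A real symmetric matrix of positive size has finitely many eigenvalues and
   at least one, so the supremum below is then its largest eigenvalue. *)
Definition principal_eigenvalue (R : realType) (N : nat) (A : 'M[R]_N) : R :=
  sup [set x : R | eigenvalue A x].

(* Mutual independence, under P, of the set systems F i for i in D. *)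
Definition mutually_independent (R : realType) (d : measure_display)
    (Omega : measurableType d) (P : probability Omega R) (I : choiceType)
    (D : set I) (F : I -> set (set Omega)) : Prop :=
  forall (J : {fset I}) (A : I -> set Omega),
    [set` J] `<=` D -> (forall i, i \in J -> F i (A i)) ->
    P (\bigcap_(i in [set` J]) A i) = (\prod_(i <- J) P (A i))%E.

(* The sigma-algebra generated by (X t) for t in [0, T]. *)
Definition process_sigma_algebra (R : realType) (Omega : Type) (T : R)
    (X : R -> Omega -> bool) : set (set Omega) :=
  <<s \bigcup_(t in `[0, T]) preimage_set_system setT (X t) measurable >>.

(* Equality of all finite-dimensional distributions over [0, T]. *)
Definition identically_distributed (R : realType) (d : measure_display)
    (Omega : measurableType d) (P : probability Omega R) (T : R)
    (X Y : R -> Omega -> bool) : Prop :=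
  forall (n : nat) (t : 'I_n -> R) (v : 'I_n -> bool),
    (forall k, t k \in `[0, T]) ->
    P [set w | forall k, X (t k) w = v k] =
    P [set w | forall k, Y (t k) w = v k].

Definition cadlag (R : realType) (T : R) (x : R -> R) : Prop :=
  (forall t, t \in `[0, T[ -> x s @[s --> t^'+] --> x t) /\
  (forall t, t \in `]0, T] -> cvg (x s @[s --> t^'-])).

(* State during the n-th sojourn of a path that starts in b, with n = 0 for
   the first sojourn. *)
Definition sojourn_state (b : bool) (n : nat) : bool := b (+) odd n.

(* Time at which the n-th sojourn starts, for a path that starts in b and whose
   k-th visit to state c has length s c k. The visits alternate, so the m-th
   sojourn is the (m / 2)-th visit to its state. *)
Definition jump_time (R : realType) (b : bool) (s : bool -> nat -> R)
    (n : nat) : R :=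
  \sum_(m < n) s (sojourn_state b m) m./2.

(* A process on [0, T] alternating between the states true (edge present) and
   false (edge absent): it starts in true with probability p0, its sojourns in
   true and in false are exponential with rates lon and loff, and all of them
   are independent of each other and of the initial state. The index None
   stands for the initial state and Some (c, k) for the k-th visit to c. *)
Definition alternating_process (R : realType) (d : measure_display)
    (Omega : measurableType d) (P : probability Omega R) (T p0 lon loff : R)
    (X : R -> Omega -> bool) : Prop :=
  P [set w | X 0 w] = p0%:E /\
  exists S : bool -> nat -> {RV P >-> R},
    [/\ forall c k (B : set R), measurable B ->
          distribution P (S c k) B =
          exponential_prob (if c then lon else loff) B,
        mutually_independent P setT
          (fun i : option (bool * nat) =>
             match i with
             | None => preimage_set_system setT (X 0) measurable
             | Some (c, k) => preimage_set_system setT (S c k) measurable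
             end)
      & {ae P, forall w, forall (n : nat) (t : R), t \in `[0, T] ->
          jump_time (X 0 w) (fun c k => S c k w) n <= t <
            jump_time (X 0 w) (fun c k => S c k w) n.+1 ->
          X t w = sojourn_state (X 0 w) n}].

(* a i j t w says whether the edge {i, j} (a self-loop when i = j) is present
   at time t. *)
Record dynamic_ER (R : realType) (d : measure_display)
    (Omega : measurableType d) (P : probability Omega R) (T p0 lon loff : R)
    (N : nat) (a : 'I_N -> 'I_N -> R -> Omega -> bool) : Prop := DynamicER {
  ER_sym : forall i j, a i j = a j i ;
  ER_measurable : forall i j t, t \in `[0, T] ->
    measurable_fun setT (a i j t) ;
  ER_cadlag : forall i j w, cadlag T (fun t => (a i j t w)%:R) ;
  ER_independent :
    mutually_independent P [set e : 'I_N * 'I_N | (e.1 <= e.2)%N]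
      (fun e => process_sigma_algebra T (a e.1 e.2)) ;
  ER_identically_distributed : forall i j k l,
    identically_distributed P T (a i j) (a k l) ;
  ER_alternating : forall i j,
    alternating_process P T p0 lon loff (a i j)
}.

Definition adjacency (R : realType) (Omega : Type) (N : nat)
    (a : 'I_N -> 'I_N -> R -> Omega -> bool) (t : R) (w : Omega) : 'M[R]_N :=
  \matrix_(i, j) (a i j t w)%:R.

Definition edge_prob (R : realType) (d : measure_display)
    (Omega : measurableType d) (P : probability Omega R)
    (X : R -> Omega -> bool) (t : R) : R :=
  fine (P [set w | X t w]).

(* Main.v *)
Require Import Defs.
From HB Require Import structures.
From mathcomp Require Import all_boot all_order all_algebra finmap.
From mathcomp Require Import all_classical all_reals all_analysis.
From mathcomp Require Import ring lra zify.

(** Write [n] for the number of vertices, [p] for the edge probability, [m] for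
    [n * p], [J] for the all-ones matrix and [A = p J + H] for the adjacency
    matrix at time [t]: [H] is symmetric, and its entries on and above the
    diagonal are independent, centered and bounded by 1. Let [h] be the vector
    of row sums of [H] and [s] the sum of all its entries. The principal
    eigenvalue [mu] solves a secular equation: an eigenvector normalized so that
    [p J x] is the all-ones vector [1] satisfies [mu x = 1 + H x]. Substituting
    this relation three times into itself and pairing with [1] gives

      [(mu - m) mu^3 = p (s mu^2 + |h|^2 mu + <h, H h> + r)]

    where [r] is of order [|H h|^2 / m]. Replacing [mu] by [m] in the
    coefficients yields the deterministic estimate

      [mu = m + s / n + |h|^2 / (n m) + <h, H h> / (n m^2) + error]

    ([principal_eigenvalue_estimate]). It is valid as soon as [H] contracts
    vectors by [m / 4]. That follows from a bound on the sum [Phi] of the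
    squared off-diagonal entries of [H^2], since the diagonal of [H^2] is at
    most [n]. When [Phi] is too large for this, all terms are at most of order
    [n] while [Phi^2 / n^7] is at least of that order, so adding a multiple of
    [Phi^2 / n^7] to the error makes the estimate true for every [H], and no
    conditioning on a good event is needed.

    It remains to take expectations ([Ex_principal_eigenvalue]): [s] has mean 0,
    [|h|^2] has mean [n^2 p (1 - p)] and so contributes exactly [1 - p], and
    [<h, H h>] has mean of order [n^2]. The error involves the means of [s^2],
    [|h|^4], [|H h|^2] and [Phi^2], of orders [n^2], [n^4], [n^3] and [n^6].
    All of these come from one fact: the mean of a product of centered entries
    vanishes as soon as one entry occurs only once, so that in a product of four
    the entries must be paired off.
    Each contribution to the error is then of order [1 / n], with a constant
    depending only on a positive lower bound of [p].

    Such a lower bound, uniform in [t] and [n], is [p0 * exp (- lon T)]: an edge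
    that is present at time 0 and whose first sojourn exceeds [T] is present
    throughout [0, T] ([edge_prob_ge]). The joint law of the edges at time [t]
    is a product of Bernoulli laws by independence ([prob_snapshot]), so the
    expectation of [mu] is a finite weighted sum over the edge configurations. *)

Set Implicit Arguments.
Unset Strict Implicit.
Unset Printing Implicit Defensive.

Import Order.TTheory GRing.Theory Num.Theory.
Import numFieldNormedType.Exports.

Local Open Scope classical_set_scope.
Local Open Scope ring_scope.

(** * Inner products and the Rayleigh quotient *)

Lemma sum_cauchy_schwarz (R : realFieldType) (I : finType) (P : pred I)
    (f g : I -> R) :
  (\sum_(i | P i) f i * g i) ^+ 2 <=
  (\sum_(i | P i) f i ^+ 2) * (\sum_(i | P i) g i ^+ 2).
Proof.
set a := \sum_(i | P i) f i ^+ 2; set b := \sum_(i | P i) g i ^+ 2.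
set c := \sum_(i | P i) f i * g i.
have b0 : 0 <= b by apply: sumr_ge0 => i _; exact: sqr_ge0.
have H : 0 <= b * (a * b - c ^+ 2).
  have -> : b * (a * b - c ^+ 2) = \sum_(i | P i) (b * f i - c * g i) ^+ 2.
    rewrite (eq_bigr (fun i => b ^+ 2 * f i ^+ 2 + - (2 * b * c) * (f i * g i) +
      c ^+ 2 * g i ^+ 2)); last by move=> i _; ring.
    by rewrite !big_split/= -!mulr_sumr -/a -/b -/c; ring.
  by apply: sumr_ge0 => i _; exact: sqr_ge0.
have [b_gt0|] := ltP 0 b; first by rewrite pmulr_rge0 // subr_ge0 in H.
move=> b_le0; have b00 : b = 0 by apply/eqP; rewrite eq_le b_le0 b0.
have g0 i : P i -> g i = 0.
  move=> Pi; apply/eqP; rewrite -sqrf_eq0.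
  by have/psumr_eq0P -> := b00 => // j _; exact: sqr_ge0.
by rewrite b00 mulr0 /c big1 ?expr0n// => i Pi; rewrite g0 // mulr0.
Qed.

Lemma sqr_sum_le (R : realFieldType) (I : finType) (P : pred I) (f : I -> R) :
  (\sum_(i | P i) f i) ^+ 2 <= #|P|%:R * \sum_(i | P i) f i ^+ 2.
Proof.
have := sum_cauchy_schwarz P (fun=> 1) f.
under eq_bigr do rewrite mul1r; move=> /le_trans; apply.
by under eq_bigr do rewrite expr1n; rewrite sumr_const.
Qed.

(** Euclidean inner product of row vectors. *)
Definition dot (R : pzSemiRingType) n (u v : 'rV[R]_n) : R :=
  \sum_i u 0 i * v 0 i.

Section dot_theory.
Context {R : realFieldType} {n : nat}.
Implicit Types (u v w : 'rV[R]_n) (A : 'M[R]_n).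

Lemma dotC u v : dot u v = dot v u.
Proof. by apply: eq_bigr => i _; rewrite mulrC. Qed.

Lemma dotDl u v w : dot (u + v) w = dot u w + dot v w.
Proof. by rewrite -big_split/=; apply: eq_bigr => i _; rewrite mxE mulrDl. Qed.

Lemma dotDr u v w : dot w (u + v) = dot w u + dot w v.
Proof. by rewrite dotC dotDl dotC [dot v w]dotC. Qed.

Lemma dotZl k u w : dot (k *: u) w = k * dot u w.
Proof. by rewrite mulr_sumr; apply: eq_bigr => i _; rewrite mxE mulrA. Qed.

Lemma dotZr k u w : dot w (k *: u) = k * dot w u.
Proof. by rewrite dotC dotZl dotC. Qed.

Lemma dotNl u w : dot (- u) w = - dot u w.
Proof. by rewrite -scaleN1r dotZl mulN1r. Qed.

Lemma dotBl u v w : dot (u - v) w = dot u w - dot v w.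
Proof. by rewrite dotDl dotNl. Qed.

Lemma dot_ge0 u : 0 <= dot u u.
Proof. by apply: sumr_ge0 => i _; rewrite -expr2 sqr_ge0. Qed.

Lemma dot_eq0 u : (dot u u == 0) = (u == 0).
Proof.
apply/eqP/eqP => [u0|->]; last by rewrite /dot big1// => i _; rewrite mxE mul0r.
apply/rowP => i; rewrite mxE; apply/eqP; rewrite -sqrf_eq0 expr2.
by move/psumr_eq0P : u0 => -> // j _; rewrite -expr2 sqr_ge0.
Qed.

Lemma dot_gt0 u : u != 0 -> 0 < dot u u.
Proof. by move=> u0; rewrite lt_neqAle dot_ge0 eq_sym dot_eq0 u0. Qed.

Lemma dot_cauchy_schwarz u v : dot u v ^+ 2 <= dot u u * dot v v.
Proof. exact: sum_cauchy_schwarz. Qed.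

Lemma dot_mulmx_sym A u v : A^T = A -> dot (u *m A) v = dot u (v *m A).
Proof.
move=> sA; have E x y : dot x y = (x *m y^T) 0 0 :> R.
  by rewrite mxE; apply: eq_bigr => i _; rewrite mxE.
by rewrite !E trmx_mul sA mulmxA.
Qed.

(** Cauchy--Schwarz for the positive semidefinite form of [B], in its
    degenerate case: a vector on which the form vanishes lies in the kernel. *)
Lemma psd_form_eq0 (B : 'M[R]_n) u : B^T = B ->
  (forall v, 0 <= dot (v *m B) v) -> dot (u *m B) u = 0 -> u *m B = 0.
Proof.
move=> sB B0 u0; apply/eqP; rewrite -dot_eq0; apply/eqP.
set y := u *m B; set a := dot y y; set b := dot (y *m B) y.
have a0 : 0 <= a by exact: dot_ge0.
have b0 : 0 <= b by exact: B0.
have := B0 ((b + 1) *: u - a *: y).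
rewrite mulmxBl -!scalemxAl dotBl !dotZl -/y -scaleN1r !dotDr !dotZr.
have -> : dot (y *m B) u = a by rewrite dot_mulmx_sym.
have -> : dot y u = 0 by [].
rewrite -/a -/b => H.
suff : a ^+ 2 <= 0 by move=> a2; apply/eqP; rewrite -sqrf_eq0 eq_le a2 sqr_ge0.
have a2 := sqr_ge0 a.
have ab : 0 <= b * a ^+ 2 by rewrite mulr_ge0.
nra.
Qed.

End dot_theory.

Section rayleigh.
Context {R : realType}.

Lemma dot_mulmx_continuous n (A : 'M[R]_n) :
  continuous (fun u : 'rV[R]_n => dot (u *m A) u).
Proof.
have S (I : finType) (F : I -> 'rV[R]_n -> R) :
    (forall i, continuous (F i)) -> continuous (fun u => \sum_i F i u).
  by move=> cF; apply: continuous_big => // -[x y]; exact: add_continuous.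
have C i : continuous (fun u : 'rV[R]_n => u 0 i).
  by move=> u; exact: (@coord_continuous R 1 n 0 i u).
have CA i : continuous (fun u : 'rV[R]_n => (u *m A) 0 i).
  have -> : (fun u : 'rV[R]_n => (u *m A) 0 i) = fun u => \sum_k u 0 k * A k i.
    by apply/funext => v; rewrite mxE.
  by apply: S => k u; apply: continuousM; [exact: C|exact: cst_continuous].
by apply: S => i u; apply: continuousM; [exact: CA|exact: C].
Qed.

(** The maximum of the Rayleigh quotient over the unit sphere is attained by
    compactness, and a maximizer is an eigenvector. *)
Lemma principal_eigenvalueP n (A : 'M[R]_n) : (0 < n)%N -> A^T = A ->
  eigenvalue A (principal_eigenvalue A) /\
  forall u, dot (u *m A) u <= principal_eigenvalue A * dot u u.
Proof.
move=> n0 sA; pose S := [set u : 'rV[R]_n | dot (u *m 1%:M) u = 1].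
have SE u : S u <-> dot u u = 1 by rewrite /S/= mulmx1.
have S0 : S !=set0.
  exists (delta_mx 0 (Ordinal n0)); apply/SE; rewrite /dot (bigD1 (Ordinal n0))//=.
  rewrite !mxE !eqxx mulr1 big1 ?addr0// => i i0.
  by rewrite !mxE eqxx (negbTE i0) mulr0.
have cS : compact S.
  apply: bounded_closed_compact.
    exists 1; split; first exact: real1.
    move=> M M1 u /SE u1; apply: le_trans (ltW M1).
    rewrite [leLHS]/Num.norm/= mx_normrE; apply/bigmax_leP; split => //= -[i j] _ /=.
    rewrite -(@ler_pXn2r _ 2) ?nnegrE ?normr_ge0// real_normK ?num_real// expr1n.
    rewrite -u1 /dot (bigD1 j)//= (ord1 i) expr2 lerDl sumr_ge0// => k _.
    by rewrite -expr2 sqr_ge0.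
  have -> : S = (fun u => dot (u *m 1%:M) u) @^-1` [set x | x = 1] by [].
  by move/continuous_closedP: (@dot_mulmx_continuous n 1%:M); apply; exact: closed_eq.
have [c cS' cmax] := @compact_EVT_max _ _ _ S S0 cS
  (continuous_subspaceT (@dot_mulmx_continuous n A)).
have c1 : dot c c = 1 by apply/SE; rewrite inE in cS'.
pose m := dot (c *m A) c.
have ray u : dot (u *m A) u <= m * dot u u.
  have [->|u0] := eqVneq u 0.
    by rewrite mul0mx /dot !big1 ?mulr0// => i _; rewrite mxE mul0r.
  have du := dot_gt0 u0; pose r := Num.sqrt (dot u u).
  have r0 : 0 < r by rewrite sqrtr_gt0.
  have r2 : r ^+ 2 = dot u u by rewrite sqr_sqrtr// ltW.
  have := cmax (r^-1 *: u); rewrite inE => /(_ _); rewrite SE -scalemxAl !dotZl !dotZr.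
  have -> : r^-1 * (r^-1 * dot u u) = 1 by rewrite -r2; field; rewrite gt_eqF.
  move=> /(_ erefl); rewrite -/m -r2 => mr.
  have -> : dot (u *m A) u = r ^+ 2 * (r^-1 * (r^-1 * dot (u *m A) u)).
    by field; rewrite gt_eqF.
  by rewrite mulrC ler_pM2r ?exprn_gt0.
have eA : c *m A = m *: c.
  apply/eqP; rewrite eq_sym -subr_eq0 -mul_mx_scalar -mulmxBr; apply/eqP.
  apply: psd_form_eq0.
  - by rewrite linearB/= tr_scalar_mx sA.
  - by move=> v; rewrite mulmxBr mul_mx_scalar dotBl dotZl subr_ge0.
  - by rewrite mulmxBr mul_mx_scalar dotBl dotZl c1 mulr1 subrr.
have em : eigenvalue A m.
  apply/eigenvalueP; exists c => //; apply: contraTneq isT => c0.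
  by move: c1; rewrite c0 /dot big1 => [/esym/eqP|i _]; rewrite ?oner_eq0// mxE mul0r.
have mub : ubound [set x | eigenvalue A x] m.
  move=> x /= /eigenvalueP[v vA v0]; have := ray v.
  by rewrite vA dotZl ler_pM2r// dot_gt0.
suff -> : principal_eigenvalue A = m by [].
apply/eqP; rewrite eq_le; apply/andP; split.
  by apply: ge_sup => //; exists m.
by apply: ub_le_sup => //; exists m.
Qed.

Lemma eigenvalue_norm_le n (A : 'M[R]_n) a : (forall i j, `|A i j| <= 1) ->
  eigenvalue A a -> `|a| <= n%:R.
Proof.
move=> A1 /eigenvalueP[v vA v0].
have dv := dot_gt0 v0.
have : \sum_j `|a * v 0 j| <= n%:R * \sum_j `|v 0 j|.
  have -> : n%:R * (\sum_j `|v 0 j|) = \sum_(i < n) \sum_j `|v 0 j|.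
    by rewrite sumr_const card_ord mulr_natl.
  apply: ler_sum => j _; move/rowP/(_ j) : vA; rewrite !mxE => <-.
  apply: (le_trans (ler_norm_sum _ _ _)); apply: ler_sum => i _.
  by rewrite normrM ler_piMr.
under eq_bigr do rewrite normrM; rewrite -mulr_sumr ler_pM2r//.
have [i vi] : exists i, v 0 i != 0.
  apply/existsP; apply: contraNT v0; rewrite negb_exists => /forallP H.
  by apply/eqP/rowP => i; rewrite mxE; apply/eqP; rewrite -[_ == _]negbK H.
by rewrite (bigD1 i)//= ltr_pwDl ?normr_gt0// sumr_ge0.
Qed.

End rayleigh.

(** * Expansion of the principal eigenvalue *)

Section perturbation.
Context {R : realType} {n : nat}.
Implicit Types (H : 'M[R]_n) (p : R) (x : 'rV[R]_n).

(** The all-ones row vector. *)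
Definition ones : 'rV[R]_n := const_mx 1.

(** Row of the column sums of [H]; it plays the role of the vector [h] above. *)
Definition degrees H : 'rV[R]_n := ones *m H.

(** Sum [s] of all entries of [H]. *)
Definition total H : R := dot ones (degrees H).

(** [|h|^2], the sum of the entries of [H^2]. *)
Definition degrees_sqr H : R := dot (degrees H) (degrees H).

(** [<h, H h>], the weight of all walks of length 3. *)
Definition cubic_walks H : R := dot (degrees H) (degrees H *m H).

(** [|H h|^2]: the coordinates of [h H] are the weights of the walks of length 2
    ending at a given vertex. *)
Definition walks2_sqr H : R := dot (degrees H *m H) (degrees H *m H).

(** The sum [Phi] of the squared off-diagonal entries of [H^2]. *)
Definition offdiag_sqr H : R :=
  \sum_(e : 'I_n * 'I_n | e.1 != e.2) (H *m H) e.1 e.2 ^+ 2.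

Lemma dot_ones_ones : dot ones ones = n%:R.
Proof.
rewrite /dot (eq_bigr (fun=> 1)) => [|i _]; last by rewrite mxE mulr1.
by rewrite sumr_const card_ord.
Qed.

Lemma mulmx_const x p : x *m (const_mx p : 'M[R]_n) = (p * dot x ones) *: ones.
Proof.
apply/rowP => j; rewrite !mxE mulr1 mulr_sumr; apply: eq_bigr => i _.
by rewrite !mxE mulr1 mulrC.
Qed.

Lemma offdiag_sqr_ge0 H : 0 <= offdiag_sqr H.
Proof. by apply: sumr_ge0 => e _; exact: sqr_ge0. Qed.

(** Operator norm bound: the diagonal of [H^2] is at most [n], and its
    off-diagonal part is bounded by its Frobenius norm. *)
Lemma dot_mulmx_le H (r : R) x : H^T = H -> (forall i j, `|H i j| <= 1) ->
  0 <= r -> offdiag_sqr H <= r ^+ 2 ->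
  dot (x *m H) (x *m H) <= (n%:R + r) * dot x x.
Proof.
move=> sH H1 r0 Hr; rewrite -(dot_mulmx_sym _ _ sH) -mulmxA.
have -> : dot (x *m (H *m H)) x =
    \sum_i (H *m H) i i * x 0 i ^+ 2 +
    \sum_(e : 'I_n * 'I_n | e.1 != e.2) (H *m H) e.1 e.2 * (x 0 e.1 * x 0 e.2).
  transitivity (\sum_(e : 'I_n * 'I_n) (H *m H) e.1 e.2 * (x 0 e.1 * x 0 e.2)).
    rewrite -(pair_bigA _ (fun i j => (H *m H) i j * (x 0 i * x 0 j)))/=.
    rewrite exchange_big/=; apply: eq_bigr => i _; rewrite mxE mulr_suml.
    by apply: eq_bigr => j _; rewrite mulrCA mulrA.
  rewrite (bigID (fun e : 'I_n * 'I_n => e.1 == e.2))/=; congr (_ + _).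
  rewrite (reindex_onto (fun i => (i, i)) fst)/=; last first.
    by move=> [i j] /= /eqP ->.
  apply: eq_big => [i|i _]; first by rewrite !eqxx.
  by rewrite expr2.
rewrite mulrDl; apply: lerD.
  rewrite mulr_sumr; apply: ler_sum => i _; rewrite -expr2 ler_wpM2r ?sqr_ge0//.
  rewrite mxE -[n in n%:R]card_ord -sumr_const; apply: ler_sum => j _.
  have := H1 i j; rewrite -{2}sH mxE => H1'; apply: le_trans (ler_norm _) _.
  by rewrite normrM -[1]mulr1 ler_pM.
apply: le_trans (ler_norm _) _.
rewrite -(@ler_pXn2r _ 2) ?nnegrE ?normr_ge0 ?mulr_ge0 ?dot_ge0//.
rewrite real_normK ?num_real//.
apply: le_trans (sum_cauchy_schwarz _ _ _) _.
rewrite exprMn; apply: ler_pM => //.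
- exact: offdiag_sqr_ge0.
- by apply: sumr_ge0 => e _; exact: sqr_ge0.
rewrite expr2 {1}/dot mulr_suml.
under [leRHS]eq_bigr do rewrite mulr_sumr.
rewrite pair_bigA/= [leRHS](bigID (fun e : 'I_n * 'I_n => e.1 != e.2))/=.
rewrite -[leLHS]addr0 lerD//.
  by apply: ler_sum => e _; rewrite exprMn !expr2.
by apply: sumr_ge0 => e _; rewrite -!expr2 mulr_ge0// sqr_ge0.
Qed.

(** The secular equation of a rank one perturbation, expanded to third order. *)
Lemma eigenvalue_expansion H p : (0 < n)%N -> 0 < p ->
    H^T = H ->
    (forall x, dot (x *m H) (x *m H) <= (n%:R * p / 4) ^+ 2 * dot x x) ->
  let mu := principal_eigenvalue (const_mx p + H) in
  let m := n%:R * p in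
  3 / 4 * m <= mu /\
  exists2 r, 0 <= r <= 2 * walks2_sqr H / m &
    (mu - m) * mu ^+ 3 =
    p * (total H * mu ^+ 2 + degrees_sqr H * mu + cubic_walks H + r).
Proof.
move=> n0 p0 sH HK mu m; rewrite -/m in HK.
have n0' : 0 < n%:R :> R by rewrite ltr0n.
have m0 : 0 < m by rewrite mulr_gt0.
have mE : m = n%:R * p by [].
have HK2 x y : dot (x *m H) y ^+ 2 <= (m / 4) ^+ 2 * (dot x x * dot y y).
  rewrite mulrA; apply: le_trans (dot_cauchy_schwarz _ _) _.
  by rewrite ler_wpM2r ?dot_ge0.
have HK1 x : `|dot (x *m H) x| <= m / 4 * dot x x.
  rewrite -(@ler_pXn2r _ 2) ?nnegrE ?normr_ge0 ?mulr_ge0 ?dot_ge0//; last by lra.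
  by rewrite real_normK ?num_real// exprMn [dot x x ^+ 2]expr2.
have sA : (const_mx p + H)^T = const_mx p + H.
  by rewrite linearD/= trmx_const sH.
have [/eigenvalueP[w wA w0] ray] := principal_eigenvalueP n0 sA.
rewrite -/mu in wA ray.
have AE x : x *m (const_mx p + H) = (p * dot x ones) *: ones + x *m H.
  by rewrite mulmxDr mulmx_const.
have mu_ge : 3 / 4 * m <= mu.
  have := ray ones; rewrite AE dotDl dotZl dot_ones_ones => H1.
  have := HK1 ones; rewrite dot_ones_ones => /ler_normlP[H2 _].
  have H3 : (3 / 4 * m) * n%:R <= mu * n%:R by rewrite mE in H2 *; nra.
  by rewrite ler_pM2r in H3.
split => //.
have mu_gt : m / 4 < mu by lra.
pose c := dot w ones.
(* Otherwise [w] would be an eigenvector of [H] for [mu], but [H] contracts by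
   [m / 4] < [mu]. *)
have c0 : c != 0.
  apply/eqP => c0; move: wA; rewrite AE -/c c0 mulr0 scale0r add0r => wH.
  have := HK w; rewrite wH dotZl dotZr mulrA -expr2 ler_pM2r ?dot_gt0//.
  by move=> H1; nra.
pose x := (p * c)^-1 *: w.
have pc0 : p * c != 0 by rewrite mulf_neq0// gt_eqF.
have xE : mu *: x = ones + x *m H.
  rewrite /x scalerA mulrC -scalerA -wA AE -/c scalerDr scalerA mulVf// scale1r.
  by rewrite -scalemxAl.
pose y := x *m H; pose h := degrees H.
have yE : mu *: y = h + y *m H by rewrite /y scalemxAl xE mulmxDl.
pose z := y *m H.
have zE : mu *: z = h *m H + z *m H by rewrite /z scalemxAl yE mulmxDl.
have e0 : mu = m + p * dot h x.
  have : dot (mu *: x) ones = n%:R + dot h x.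
    by rewrite xE dotDl dot_ones_ones dotC -dot_mulmx_sym// dotC dotC.
  rewrite dotZl /x dotZl -/c -/x => E1.
  have -> : m + p * dot h x = p * (n%:R + dot h x) by rewrite mE; ring.
  by rewrite -E1; field; rewrite c0 gt_eqF.
have e1 : mu * dot h x = total H + dot h y.
  by rewrite -dotZr xE dotDr dotC.
have e2 : mu * dot h y = degrees_sqr H + dot h z.
  by rewrite -dotZr yE dotDr.
have e3 : mu * dot h z = cubic_walks H + dot (h *m H) z.
  by rewrite -dotZr zE dotDr -(dot_mulmx_sym h z sH).
exists (dot (h *m H) z); last first.
  rewrite {1}e0; transitivity (p * (mu * (mu * (mu * dot h x)))); first by ring.
  by rewrite e1 !mulrDr e2 !mulrDr e3; ring.
(* [z] solves [(mu - H) z = H h], and [mu - H] is at least [m / 2]. *)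
set r := dot (h *m H) z.
have rE : r = mu * dot z z - dot (z *m H) z.
  by rewrite -dotZl zE dotDl addrK.
have r_ge : m / 2 * dot z z <= r.
  have /ler_normlP[_ ] := HK1 z; have := dot_ge0 z; rewrite rE; nra.
have zz := dot_ge0 z.
have r0 : 0 <= r by apply: le_trans r_ge; rewrite mulr_ge0//; lra.
rewrite r0/=.
have r2 : r ^+ 2 <= walks2_sqr H * dot z z := dot_cauchy_schwarz _ _.
have q0 : 0 <= walks2_sqr H by exact: dot_ge0.
rewrite ler_pdivlMr//.
have [r_gt0|r_le0] := ltP 0 r; last by nra.
rewrite -(ler_pM2l r_gt0) mulrA -expr2.
nra.
Qed.

End perturbation.

(** Replacing [mu] by [m] in the expanded secular equation. With [dl] for
    [|mu - m|], the replacement costs at most a constant times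
    [dl * (|s| / m^2 + h2 / m^3)], and [dl] itself is at most a constant times
    [|s| / m + h2 / m^2]. *)
Lemma expansion_bound (R : realFieldType) (p m mu s h2 t q r : R) :
  0 < p <= 1 -> 0 < m -> 3 / 4 * m <= mu ->
  0 <= h2 -> `|t| <= m / 4 * h2 -> 0 <= q <= (m / 4) ^+ 2 * h2 ->
  0 <= r <= 2 * q / m ->
  (mu - m) * mu ^+ 3 = p * (s * mu ^+ 2 + h2 * mu + t + r) ->
  `|mu - m - p * (s / m + h2 / m ^+ 2 + t / m ^+ 3)| <=
    13 * s ^+ 2 / m ^+ 3 + 27 * h2 ^+ 2 / m ^+ 5 + 5 * q / m ^+ 4.
Proof.
move=> /andP[p0 p1] m0 mu_m h20 tm /andP[q0 qm] /andP[r0 rm] muE.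
have mu0 : 0 < mu by lra.
pose v := m^-1; pose u := mu^-1.
have v0 : 0 < v by rewrite invr_gt0.
have u0 : 0 < u by rewrite invr_gt0.
have vn k : 0 <= v ^+ k by rewrite exprn_ge0 ?ltW.
have mv : m * v = 1 by rewrite mulfV ?gt_eqF.
have muu : mu * u = 1 by rewrite mulfV ?gt_eqF.
have uv : u <= 4 / 3 * v.
  by rewrite -(ler_pM2l mu0) muu; nra.
pose dl := `|mu - m|.
have dl0 : 0 <= dl by exact: normr_ge0.
have dE : mu - m = p * (s * u + h2 * u ^+ 2 + (t + r) * u ^+ 3).
  have -> : mu - m = ((mu - m) * mu ^+ 3) * u ^+ 3.
    by rewrite -mulrA -exprMn muu expr1n mulr1.
  rewrite muE; transitivity (p * (s * (mu * u) ^+ 2 * u + h2 * (mu * u) * u ^+ 2 +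
    (t + r) * u ^+ 3)); first by ring.
  by rewrite muu; ring.
have u2 : u ^+ 2 <= 16 / 9 * v ^+ 2 by nra.
have u3 : u ^+ 3 <= 64 / 27 * v ^+ 3.
  have : u * u ^+ 2 <= (4 / 3 * v) * (16 / 9 * v ^+ 2).
    by apply: ler_pM => //; rewrite ?exprn_ge0 ?ltW.
  by rewrite -exprS; nra.
have tv : `|t| * v <= h2 / 4.
  have := ler_wpM2r (ltW v0) tm.
  have -> : m / 4 * h2 * v = (m * v) * h2 / 4 by ring.
  by rewrite mv mul1r.
have rqv : r <= 2 * q * v by [].
have qv2 : q * v ^+ 2 <= h2 / 16.
  have := ler_wpM2r (exprn_ge0 2 (ltW v0)) qm.
  have -> : (m / 4) ^+ 2 * h2 * v ^+ 2 = (m * v) ^+ 2 * h2 / 16 by field.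
  by rewrite mv expr1n mul1r.
have rv : r * v <= h2 / 8.
  have := ler_wpM2r (ltW v0) rqv.
  have -> : 2 * q * v * v = 2 * (q * v ^+ 2) by ring.
  by move=> /le_trans; apply; lra.
have dl_le : dl <= p * (4 / 3 * (`|s| * v) + 3 * (h2 * v ^+ 2)).
  rewrite /dl dE normrM (gtr0_norm p0) ler_pM2l//.
  apply: le_trans (ler_normD _ _) _.
  have T1 : `|(t + r) * u ^+ 3| <= 64 / 27 * (3 / 8) * (h2 * v ^+ 2).
    rewrite normrM (ger0_norm (exprn_ge0 3 (ltW u0))).
    apply: (@le_trans _ _ ((`|t| + r) * (64 / 27 * v ^+ 3))).
      apply: ler_pM => //; first exact: exprn_ge0 (ltW u0).
      by apply: le_trans (ler_normD _ _) _; rewrite (ger0_norm r0).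
    have -> : (`|t| + r) * (64 / 27 * v ^+ 3) = 64 / 27 * v ^+ 2 * (`|t| * v + r * v).
      by field.
    have -> : 64 / 27 * (3 / 8) * (h2 * v ^+ 2) = 64 / 27 * v ^+ 2 * (h2 / 4 + h2 / 8).
      by field.
    rewrite ler_wpM2l ?lerD// mulr_ge0//; lra.
  have T2 : `|s * u + h2 * u ^+ 2| <= 4 / 3 * (`|s| * v) + 16 / 9 * (h2 * v ^+ 2).
    apply: le_trans (ler_normD _ _) _; rewrite (normrM s) (normrM h2) (gtr0_norm u0) (ger0_norm h20).
    rewrite (ger0_norm (exprn_ge0 2 (ltW u0))); apply: lerD.
      by rewrite [leRHS]mulrCA ler_wpM2l.
    by rewrite [leRHS]mulrCA ler_wpM2l.
  have : 0 <= h2 * v ^+ 2 by rewrite mulr_ge0.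
  lra.
have uvE : u - v = - ((mu - m) * (u * v)).
  by transitivity (u * (m * v) - v * (mu * u)); [rewrite mv muu; ring|ring].
have duv : `|u - v| <= 4 / 3 * (dl * v ^+ 2).
  rewrite uvE normrN normrM -/dl mulrCA ler_wpM2l// gtr0_norm ?mulr_gt0//.
  by rewrite expr2 mulrA ler_wpM2r// ltW.
have B k c : 0 <= k -> 0 <= c -> k <= c -> `|u - v| * k <= 4 / 3 * (dl * v ^+ 2) * c.
  by move=> k0 c0 kc; apply: ler_pM.
have d2 : `|u ^+ 2 - v ^+ 2| <= 4 * (dl * v ^+ 3).
  have -> : u ^+ 2 - v ^+ 2 = (u - v) * (u + v) by ring.
  rewrite normrM (gtr0_norm (addr_gt0 u0 v0)).
  apply: le_trans (B _ (7 / 3 * v) _ _ _) _; [clear -u0 v0 uv; lra..|].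
  have -> : 4 / 3 * (dl * v ^+ 2) * (7 / 3 * v) = 28 / 9 * (dl * v ^+ 3) by field.
  by apply: ler_wpM2r; [rewrite mulr_ge0|clear; lra].
have d3 : `|u ^+ 3 - v ^+ 3| <= 6 * (dl * v ^+ 4).
  have -> : u ^+ 3 - v ^+ 3 = (u - v) * (u ^+ 2 + u * v + v ^+ 2) by ring.
  have X : 0 <= u ^+ 2 + u * v + v ^+ 2 by clear -u0 v0; nra.
  rewrite normrM (ger0_norm X).
  apply: le_trans (B _ (37 / 9 * v ^+ 2) _ _ _) _ => //; [clear -v0; nra|clear -u0 v0 uv u2; nra|].
  have -> : 4 / 3 * (dl * v ^+ 2) * (37 / 9 * v ^+ 2) = 148 / 27 * (dl * v ^+ 4) by field.
  by apply: ler_wpM2r; [rewrite mulr_ge0|clear; lra].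
have -> : mu - m - p * (s / m + h2 / m ^+ 2 + t / m ^+ 3) =
    p * (s * (u - v) + h2 * (u ^+ 2 - v ^+ 2) + t * (u ^+ 3 - v ^+ 3) + r * u ^+ 3).
  by rewrite dE -!exprVn -/v; ring.
rewrite -!exprVn -/v normrM (gtr0_norm p0).
pose a := `|s| * v; pose b := h2 * v ^+ 2.
have a0 : 0 <= a by rewrite mulr_ge0// ltW.
have b0 : 0 <= b by rewrite mulr_ge0.
have dlv0 : 0 <= dl * v by rewrite mulr_ge0// ltW.
have S1 : `|s * (u - v)| <= 4 / 3 * (dl * v * a).
  rewrite normrM /a.
  have -> : 4 / 3 * (dl * v * (`|s| * v)) = `|s| * (4 / 3 * (dl * v ^+ 2)) by ring.
  exact: ler_wpM2l.
have S2 : `|h2 * (u ^+ 2 - v ^+ 2)| <= 4 * (dl * v * b).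
  rewrite normrM (ger0_norm h20) /b.
  have -> : 4 * (dl * v * (h2 * v ^+ 2)) = h2 * (4 * (dl * v ^+ 3)) by ring.
  exact: ler_wpM2l.
have S3 : `|t * (u ^+ 3 - v ^+ 3)| <= 6 / 4 * (dl * v * b).
  rewrite normrM; apply: (@le_trans _ _ (`|t| * (6 * (dl * v ^+ 4)))).
    exact: ler_wpM2l.
  have -> : `|t| * (6 * (dl * v ^+ 4)) = 6 * dl * v ^+ 3 * (`|t| * v) by ring.
  have -> : 6 / 4 * (dl * v * b) = 6 * dl * v ^+ 3 * (h2 / 4) by rewrite /b; field.
  by rewrite ler_wpM2l// mulr_ge0// mulr_ge0.
have S4 : `|r * u ^+ 3| <= 5 * (q * v ^+ 4).
  rewrite ger0_norm ?mulr_ge0 ?exprn_ge0 ?(ltW u0)//.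
  apply: (@le_trans _ _ (2 * q * v * (64 / 27 * v ^+ 3))).
    by apply: ler_pM => //; rewrite exprn_ge0 ?ltW.
  have -> : 2 * q * v * (64 / 27 * v ^+ 3) = 128 / 27 * (q * v ^+ 4) by field.
  by apply: ler_wpM2r; [rewrite mulr_ge0|clear; lra].
have qv4 : 0 <= q * v ^+ 4 by rewrite mulr_ge0.
have -> : 13 * s ^+ 2 * v ^+ 3 = 13 * v * a ^+ 2.
  by rewrite /a exprMn real_normK ?num_real//; ring.
have -> : 27 * h2 ^+ 2 * v ^+ 5 = 27 * v * b ^+ 2 by rewrite /b; ring.
rewrite -[5 * q * _]mulrA.
set X := (X in p * X).
have XB : X <= dl * v * (2 * a + 6 * b) + 5 * (q * v ^+ 4).
  rewrite /X.
  have := ler_normD (s * (u - v) + h2 * (u ^+ 2 - v ^+ 2) + t * (u ^+ 3 - v ^+ 3)) (r * u ^+ 3).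
  have := ler_normD (s * (u - v) + h2 * (u ^+ 2 - v ^+ 2)) (t * (u ^+ 3 - v ^+ 3)).
  have := ler_normD (s * (u - v)) (h2 * (u ^+ 2 - v ^+ 2)).
  have : 0 <= dl * v * a by rewrite mulr_ge0.
  have : 0 <= dl * v * b by rewrite mulr_ge0.
  have -> : dl * v * (2 * a + 6 * b) = 2 * (dl * v * a) + 6 * (dl * v * b) by ring.
  by lra.
have X0 : 0 <= X by exact: normr_ge0.
have D1 : dl <= 4 / 3 * a + 3 * b.
  apply: le_trans dl_le _; rewrite -/a -/b; clear -p0 p1 a0 b0; nra.
apply: (@le_trans _ _ X); first by rewrite ler_piMl.
apply: (le_trans XB); rewrite lerD2r.
have -> : dl * v * (2 * a + 6 * b) = v * (dl * (2 * a + 6 * b)) by ring.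
have -> : 13 * v * a ^+ 2 + 27 * v * b ^+ 2 = v * (13 * a ^+ 2 + 27 * b ^+ 2) by ring.
rewrite ler_pM2l//.
apply: (@le_trans _ _ ((4 / 3 * a + 3 * b) * (2 * a + 6 * b))).
  by apply: ler_wpM2r D1; clear -a0 b0; lra.
rewrite -subr_ge0.
have -> : 13 * a ^+ 2 + 27 * b ^+ 2 - (4 / 3 * a + 3 * b) * (2 * a + 6 * b) =
    7 * (a - b) ^+ 2 + 10 / 3 * a ^+ 2 + 2 * b ^+ 2 by field.
by rewrite !addr_ge0// mulr_ge0 ?sqr_ge0// divr_ge0.
Qed.

Section estimate.
Context {R : realType} {n : nat}.
Implicit Types (H : 'M[R]_n) (p : R).

Lemma dot_norm_le (u v : 'rV[R]_n) (b c : R) :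
  (forall i, `|u 0 i| <= b) -> (forall i, `|v 0 i| <= c) ->
  `|dot u v| <= n%:R * (b * c).
Proof.
move=> ub vc; apply: le_trans (ler_norm_sum _ _ _) _.
rewrite mulr_natl -[n in leRHS]card_ord -sumr_const.
by apply: ler_sum => i _; rewrite normrM ler_pM.
Qed.

Lemma mulmx_norm_le H (u : 'rV[R]_n) (b : R) : (forall i j, `|H i j| <= 1) ->
  (forall i, `|u 0 i| <= b) -> forall i, `|(u *m H) 0 i| <= n%:R * b.
Proof.
move=> H1 ub i; rewrite mxE; apply: le_trans (ler_norm_sum _ _ _) _.
rewrite mulr_natl -[n in leRHS]card_ord -sumr_const.
by apply: ler_sum => j _; rewrite normrM -[leRHS]mulr1 ler_pM.
Qed.

(** The estimate requires neither [n] to be large nor [H] to be small. The last two error terms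
    dominate the trivial bound [5 n / p^2] when, respectively, [offdiag_sqr H] is
    large or [n] is small. *)
Lemma principal_eigenvalue_estimate H p m : (0 < n)%N -> m = n%:R * p -> 0 < p <= 1 ->
    H^T = H -> (forall i j, `|H i j| <= 1) -> (forall i j, `|p + H i j| <= 1) ->
  `|principal_eigenvalue (const_mx p + H) - m -
     p * (total H / m + degrees_sqr H / m ^+ 2 + cubic_walks H / m ^+ 3)| <=
  13 * total H ^+ 2 / m ^+ 3 + 27 * degrees_sqr H ^+ 2 / m ^+ 5 +
  5 * walks2_sqr H / m ^+ 4 +
  (5 * 32 ^+ 4 / p ^+ 10) * (offdiag_sqr H ^+ 2 / n%:R ^+ 7) +
  (5 * 32 ^+ 2 / p ^+ 6) / n%:R.
Proof.
move=> n0 mE /andP[p0 p1] sH H1 A1; set mu := principal_eigenvalue _.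
have N0 : 0 < n%:R :> R by rewrite ltr0n.
have m0 : 0 < m by rewrite mE mulr_gt0.
have q0 : 0 <= walks2_sqr H by exact: dot_ge0.
have h0 : 0 <= degrees_sqr H by exact: dot_ge0.
have e0 : 0 <= 13 * total H ^+ 2 / m ^+ 3 + 27 * degrees_sqr H ^+ 2 / m ^+ 5 +
    5 * walks2_sqr H / m ^+ 4.
  have X k : 0 <= (m ^+ k)^-1 by rewrite invr_ge0 exprn_ge0 ?ltW.
  by rewrite !addr_ge0// mulr_ge0// mulr_ge0// sqr_ge0.
have e1 : 0 <= (5 * 32 ^+ 4 / p ^+ 10) * (offdiag_sqr H ^+ 2 / n%:R ^+ 7).
  have pk k : 0 <= p ^+ k by rewrite exprn_ge0 ?ltW.
  by apply: mulr_ge0; apply: divr_ge0; rewrite ?sqr_ge0 ?pk ?mulr_ge0 ?exprn_ge0.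
have e2 : 0 <= (5 * 32 ^+ 2 / p ^+ 6) / n%:R.
  have pk k : 0 <= p ^+ k by rewrite exprn_ge0 ?ltW.
  by apply: divr_ge0 => //; apply: divr_ge0; rewrite ?pk ?mulr_ge0 ?exprn_ge0.
have crude : `|mu - m - p * (total H / m + degrees_sqr H / m ^+ 2 +
    cubic_walks H / m ^+ 3)| <= 5 * n%:R / p ^+ 2.
  have oneE i : `|(ones : 'rV[R]_n) 0 i| <= 1 by rewrite mxE normr1.
  have dE i : `|(degrees H) 0 i| <= n%:R * 1 by exact: mulmx_norm_le.
  have tE : `|total H / n%:R| <= n%:R.
    rewrite normrM normfV (gtr0_norm N0) ler_pdivrMr//.
    by have := dot_norm_le oneE dE; rewrite !mulr1 mul1r.
  have d2E : `|degrees_sqr H / n%:R ^+ 2| <= n%:R.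
    rewrite normrM normfV (gtr0_norm (exprn_gt0 2 N0)) ler_pdivrMr ?exprn_gt0//.
    by have := dot_norm_le dE dE; rewrite mulr1 expr2.
  have cE : `|cubic_walks H / n%:R ^+ 3| <= n%:R.
    rewrite normrM normfV (gtr0_norm (exprn_gt0 3 N0)) ler_pdivrMr ?exprn_gt0//.
    by have := dot_norm_le dE (mulmx_norm_le H1 dE); rewrite mulr1 !exprS expr0 mulr1.
  have muE : `|mu| <= n%:R.
    apply: eigenvalue_norm_le (principal_eigenvalueP n0 _).1.
      by move=> i j; rewrite !mxE.
    by rewrite linearD/= trmx_const sH.
  have mN : m <= n%:R by rewrite mE ler_piMr// ltW.
  have pV : 1 <= p^-1 by rewrite invf_ge1.
  have pV2 : p^-1 <= p^-1 ^+ 2 by rewrite expr2 ler_peMl// invr_ge0 ltW.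
  set t := total H / _ in tE; set d := degrees_sqr H / _ in d2E.
  set k := cubic_walks H / _ in cE.
  have -> : p * (total H / m + degrees_sqr H / m ^+ 2 + cubic_walks H / m ^+ 3) =
      t + d * p^-1 + k * p^-1 ^+ 2.
    by rewrite mE /t /d /k; field; rewrite !gt_eqF.
  have -> : 5 * n%:R / p ^+ 2 = 5 * n%:R * p^-1 ^+ 2 :> R by rewrite exprVn.
  set v := p^-1 in pV pV2 *.
  have T3 : `|k * v ^+ 2| <= n%:R * v ^+ 2.
    by rewrite normrM (ger0_norm (sqr_ge0 v)) ler_wpM2r ?sqr_ge0.
  have T2 : `|d * v| <= n%:R * v ^+ 2.
    by rewrite normrM; apply: ler_pM => //; rewrite (@ger0_norm _ v)//; lra.
  have T1 : n%:R <= n%:R * v ^+ 2 by rewrite ler_peMr ?ler0n// (le_trans pV).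
  have := ler_normB (mu - m) (t + d * v + k * v ^+ 2).
  have := ler_normB mu m; rewrite (gtr0_norm m0).
  have := ler_normD (t + d * v) (k * v ^+ 2).
  have := ler_normD t (d * v).
  by lra.
(* This [c] makes [n + c n^2], a bound on the square of the operator norm of [H],
   at most [(m / 4)^2] as soon as [1 <= c n]. *)
pose c := p ^+ 2 / 32.
have c0 : 0 < c by rewrite divr_gt0 ?exprn_gt0.
have [small|large] := ltP (c * n%:R) 1.
  apply: le_trans crude _; apply: (@le_trans _ _ ((5 * 32 ^+ 2 / p ^+ 6) / n%:R)); last by lra.
  have -> : 5 * n%:R / p ^+ 2 = (5 * 32 ^+ 2 / p ^+ 6) / n%:R * (c * n%:R) ^+ 2.
    by rewrite /c; field; rewrite !gt_eqF.
  rewrite ler_piMr// expr_le1//; first exact: ltW.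
  by rewrite mulr_ge0// ltW.
have [big|good] := ltP ((c * n%:R ^+ 2) ^+ 2) (offdiag_sqr H).
  apply: le_trans crude _.
  apply: (@le_trans _ _ ((5 * 32 ^+ 4 / p ^+ 10) * (offdiag_sqr H ^+ 2 / n%:R ^+ 7))); last by lra.
  have -> : 5 * n%:R / p ^+ 2 =
      (5 * 32 ^+ 4 / p ^+ 10) * (((c * n%:R ^+ 2) ^+ 2) ^+ 2 / n%:R ^+ 7).
    by rewrite /c; field; rewrite !gt_eqF.
  have pk k : 0 <= p ^+ k by rewrite exprn_ge0 ?ltW.
  apply: ler_wpM2l; first by apply: divr_ge0; rewrite ?pk ?mulr_ge0 ?exprn_ge0.
  rewrite ler_pM2r ?invr_gt0 ?exprn_gt0// ler_pXn2r ?nnegrE ?sqr_ge0 ?offdiag_sqr_ge0//.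
  exact: ltW.
have HK x : dot (x *m H) (x *m H) <= (m / 4) ^+ 2 * dot x x.
  apply: le_trans (dot_mulmx_le x sH H1 _ good) _.
    by rewrite mulr_ge0 ?exprn_ge0 ?ltW.
  rewrite ler_wpM2r ?dot_ge0//.
  have -> : (m / 4) ^+ 2 = 2 * c * n%:R ^+ 2 by rewrite mE /c; field.
  have -> : 2 * c * n%:R ^+ 2 = (c * n%:R) * n%:R + c * n%:R ^+ 2 by ring.
  by rewrite lerD2r ler_peMl// ltW.
have HKm := HK; rewrite mE in HKm.
have [mu_m [r r_le muE]] := eigenvalue_expansion n0 p0 sH HKm.
rewrite -/mu -mE in mu_m r_le muE.
have qh : 0 <= walks2_sqr H <= (m / 4) ^+ 2 * degrees_sqr H.
  by rewrite q0; exact: HK.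
have th : `|cubic_walks H| <= m / 4 * degrees_sqr H.
  rewrite -(@ler_pXn2r _ 2) ?nnegrE ?normr_ge0 ?mulr_ge0 ?invr_ge0 ?(ltW m0)//.
  rewrite real_normK ?num_real// exprMn [degrees_sqr H ^+ 2]expr2 mulrA mulrC.
  apply: le_trans (dot_cauchy_schwarz _ _) _.
  by rewrite ler_wpM2l//; exact: HK.
have p01 : 0 < p <= 1 by rewrite p0.
have := expansion_bound p01 m0 mu_m h0 th qh r_le muE.
by move=> /le_trans; apply; rewrite -[leRHS]addrA lerDl addr_ge0.
Qed.

End estimate.

(** * Product Bernoulli measures *)

Section bernoulli.
Context {R : realFieldType} {E : finType}.
Variable p : R.
Implicit Types (M : {ffun E -> bool}) (f g : {ffun E -> bool} -> R) (e : E).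

(** Bernoulli law of parameter [p]. *)
Definition bern (b : bool) : R := if b then p else 1 - p.

(** Product Bernoulli law on the configurations [E -> bool]. *)
Definition weight M : R := \prod_e bern (M e).

(** Expectation with respect to the product Bernoulli law. *)
Definition Ex f : R := \sum_M weight M * f M.

(** The configuration [M] with its coordinate [e] set to [b]. *)
Definition update M e b : {ffun E -> bool} := [ffun x => if x == e then b else M x].

(** [f] does not depend on the coordinate [e]. *)
Definition ignores e f := forall M b, f (update M e b) = f M.

(** Centered indicator of the coordinate [e]. *)
Definition centered e M : R := (M e)%:R - p.

Lemma ExD f g : Ex (fun M => f M + g M) = Ex f + Ex g.
Proof. by rewrite -big_split/=; apply: eq_bigr => M _; rewrite mulrDr. Qed.

Lemma ExZ k f : Ex (fun M => k * f M) = k * Ex f.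
Proof. by rewrite mulr_sumr; apply: eq_bigr => M _; rewrite mulrCA. Qed.

Lemma ExB f g : Ex (fun M => f M - g M) = Ex f - Ex g.
Proof. by rewrite -sumrB; apply: eq_bigr => M _; rewrite mulrBr. Qed.

Lemma Ex_sum (I : Type) (r : seq I) (P : pred I) (F : I -> {ffun E -> bool} -> R) :
  Ex (fun M => \sum_(i <- r | P i) F i M) = \sum_(i <- r | P i) Ex (F i).
Proof.
rewrite /Ex exchange_big/=; apply: eq_bigr => M _.
by rewrite mulr_sumr.
Qed.

Lemma eq_Ex f g : f =1 g -> Ex f = Ex g.
Proof. by move=> fg; apply: eq_bigr => M _; rewrite fg. Qed.

Lemma Ex_cst k : Ex (fun=> k) = k.
Proof.
rewrite /Ex -mulr_suml -[RHS]mul1r; congr (_ * _); rewrite /weight.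
rewrite -(bigA_distr_bigA (fun (e : E) b => bern b)) big1// => e _.
by rewrite big_bool/= addrC subrK.
Qed.

(** Averaging over a single coordinate leaves the expectation unchanged. *)
Lemma Ex_resample e f :
  Ex f = Ex (fun M => p * f (update M e true) + (1 - p) * f (update M e false)).
Proof.
pose flip M := update M e (~~ M e).
have updK M b b' : update (update M e b) e b' = update M e b'.
  by apply/ffunP => x; rewrite !ffunE; case: eqP.
have upd_id M : update M e (M e) = M.
  by apply/ffunP => x; rewrite !ffunE; case: eqP => // ->.
have upd_e M b : update M e b e = b by rewrite ffunE eqxx.
have flipK : involutive flip by move=> M; rewrite /flip updK upd_e negbK.
pose w' M := \prod_(x | x != e) bern (M x).
have wE M : weight M = bern (M e) * w' M by rewrite /weight (bigD1 e).
have w'E M b : w' (update M e b) = w' M.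
  by apply: eq_bigr => x xe; rewrite ffunE (negbTE xe).
have pairs g : 2 * (\sum_M g M) =
    \sum_M (g (update M e true) + g (update M e false)).
  rewrite mulr_natl mulr2n {2}(reindex_inj (inv_inj flipK))/= -big_split/=.
  apply: eq_bigr => M _; rewrite /flip -{1}(upd_id M).
  by case: (M e) => //=; rewrite addrC.
apply: (@mulfI _ 2); first by rewrite pnatr_eq0.
rewrite /Ex !pairs; apply: eq_bigr => M _.
by rewrite !wE !w'E !upd_e !updK /bern; ring.
Qed.

Lemma Ex_centered e g : ignores e g -> Ex (fun M => centered e M * g M) = 0.
Proof.
move=> ge; rewrite (Ex_resample e) -[RHS](Ex_cst 0); apply: eq_Ex => M.
by rewrite !ge /centered !ffunE eqxx/=; ring.
Qed.

Lemma Ex_centered_sqr e : Ex (fun M => centered e M ^+ 2) = p * (1 - p).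
Proof.
rewrite (Ex_resample e) -[RHS]Ex_cst; apply: eq_Ex => M.
by rewrite /centered !ffunE eqxx/=; ring.
Qed.

Lemma ignoresM e f g : ignores e f -> ignores e g -> ignores e (fun M => f M * g M).
Proof. by move=> fe ge M b; rewrite fe ge. Qed.

Lemma ignores_cst e k : ignores e (fun=> k).
Proof. by []. Qed.

Lemma ignores_centered e e' : e != e' -> ignores e (centered e').
Proof. by move=> ee' M b; rewrite /centered ffunE eq_sym (negbTE ee'). Qed.

Hypothesis p01 : 0 <= p <= 1.

Lemma weight_ge0 M : 0 <= weight M.
Proof.
by case/andP: p01 => p0 p1; apply: prodr_ge0 => e _; rewrite /bern; case: ifP; lra.
Qed.

Lemma le_Ex f g : (forall M, f M <= g M) -> Ex f <= Ex g.
Proof. by move=> fg; apply: ler_sum => M _; rewrite ler_wpM2l// weight_ge0. Qed.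

Lemma norm_Ex f : `|Ex f| <= Ex (fun M => `|f M|).
Proof.
apply: le_trans (ler_norm_sum _ _ _) _; apply: ler_sum => M _.
by rewrite normrM (ger0_norm (weight_ge0 M)).
Qed.

Lemma norm_Ex_le1 f : (forall M, `|f M| <= 1) -> `|Ex f| <= 1.
Proof.
by move=> f1; apply: le_trans (norm_Ex f) _; rewrite -[leRHS]Ex_cst; exact: le_Ex.
Qed.

Lemma norm_centered e M : `|centered e M| <= 1.
Proof. by case/andP: p01 => p0 p1; rewrite /centered ler_norml; case: (M e) => /=; lra. Qed.

(** Families of bounded variables [Y k], each having a private coordinate [eps k]
    of which it is a centered multiple and which no other [Y l] sees. Both the
    coordinates themselves and the terms of an off-diagonal entry of [H^2] are of
    this form. *)
Section separated.
Variables (I : finType) (eps : I -> E) (Y Z : I -> {ffun E -> bool} -> R).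
Hypothesis YE : forall k M, Y k M = centered (eps k) M * Z k M.
Hypothesis Zeps : forall k, ignores (eps k) (Z k).
Hypothesis Yeps : forall k l, l != k -> ignores (eps k) (Y l).
Hypothesis Y1 : forall k M, `|Y k M| <= 1.

Lemma Ex_isolated k f : ignores (eps k) f -> Ex (fun M => Y k M * f M) = 0.
Proof.
move=> fk; rewrite -(@Ex_centered (eps k) (fun M => Z k M * f M)).
  by apply: eq_Ex => M; rewrite YE mulrA.
exact: ignoresM.
Qed.

(** A product of four members of the family has mean 0 as soon as one index
    occurs only once; otherwise the indices can be paired off. *)
Lemma norm_Ex_Y4 k l m o :
  `|Ex (fun M => Y k M * Y l M * (Y m M * Y o M))| <=
  (k == l)%:R * (m == o)%:R + (k == m)%:R * (l == o)%:R + (k == o)%:R * (l == m)%:R.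
Proof.
have iso a b c d f : f =1 (fun M => Y a M * (Y b M * Y c M * Y d M)) ->
    b != a -> c != a -> d != a -> Ex f = 0.
  move=> fE ba ca da; rewrite (eq_Ex fE) Ex_isolated//.
  by apply: ignoresM; [apply: ignoresM|]; exact: Yeps.
have le1 : `|Ex (fun M => Y k M * Y l M * (Y m M * Y o M))| <= 1.
  apply: norm_Ex_le1 => M; rewrite !normrM.
  by rewrite !mulr_ile1// ?mulr_ge0.
have [c1|c1] := boolP ((k == l) && (m == o)).
  case/andP : c1 => -> ->; apply: (le_trans le1).
  by rewrite mulr1 -addrA lerDl addr_ge0// mulr_ge0.
have [c2|c2] := boolP ((k == m) && (l == o)).
  case/andP : c2 => -> ->; apply: (le_trans le1).
  by rewrite mulr1 addrAC lerDr addr_ge0// mulr_ge0.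
have [c3|c3] := boolP ((k == o) && (l == m)).
  case/andP : c3 => -> ->; apply: (le_trans le1).
  by rewrite mulr1 lerDr addr_ge0// mulr_ge0.
suff -> : Ex (fun M => Y k M * Y l M * (Y m M * Y o M)) = 0.
  by rewrite normr0 !addr_ge0// mulr_ge0.
have [|i1] := boolP [&& l != k, m != k & o != k].
  by case/and3P => ? ? ?; apply: (iso k l m o) => // M; ring.
have [|i2] := boolP [&& k != l, m != l & o != l].
  by case/and3P => ? ? ?; apply: (iso l k m o) => // M; ring.
have [|i3] := boolP [&& k != m, l != m & o != m].
  by case/and3P => ? ? ?; apply: (iso m k l o) => // M; ring.
have [|i4] := boolP [&& k != o, l != o & m != o].
  by case/and3P => ? ? ?; apply: (iso o k l m) => // M; ring.
exfalso; move: c1 c2 c3 i1 i2 i3 i4.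
rewrite (eq_sym l k) (eq_sym m k) (eq_sym o k) (eq_sym m l) (eq_sym o l) (eq_sym o m).
by case: (k =P l) => ?; case: (k =P m) => ?; case: (k =P o) => ?;
  case: (l =P m) => ?; case: (l =P o) => ?; case: (m =P o) => //= ?; congruence.
Qed.

Lemma Ex_sum4 : Ex (fun M => (\sum_k Y k M) ^+ 4) <= 3 * #|I|%:R ^+ 2.
Proof.
have -> : Ex (fun M => (\sum_k Y k M) ^+ 4) =
    \sum_k \sum_l \sum_m \sum_o Ex (fun M => Y k M * Y l M * (Y m M * Y o M)).
  rewrite (eq_Ex (g := fun M => \sum_k \sum_l \sum_m \sum_o
    (Y k M * Y l M * (Y m M * Y o M)))).
    rewrite Ex_sum; apply: eq_bigr => k _; rewrite Ex_sum; apply: eq_bigr => l _.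
    by rewrite Ex_sum; apply: eq_bigr => m _; rewrite Ex_sum.
  move=> M; rewrite (_ : 4%N = (2 * 2)%N)// exprM !expr2 big_distrlr/= mulr_suml.
  apply: eq_bigr => k _; rewrite mulr_suml; apply: eq_bigr => l _.
  rewrite mulr_sumr; apply: eq_bigr => m _; rewrite mulr_sumr.
  by [].
have S k : \sum_(l : I) (k == l)%:R = 1 :> R.
  rewrite (bigD1 k)//= eqxx big1 ?addr0// => l; rewrite eq_sym => /negbTE.
  by rewrite eq_sym => ->.
have -> : 3 * #|I|%:R ^+ 2 = \sum_(k : I) \sum_(l : I) \sum_(m : I) \sum_(o : I)
  ((k == l)%:R * (m == o)%:R + (k == m)%:R * (l == o)%:R + (k == o)%:R * (l == m)%:R) :> R.
  rewrite (eq_bigr (fun=> 3 * #|I|%:R)).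
    by rewrite sumr_const -mulr_natr; ring.
  move=> k _.
  rewrite (eq_bigr (fun l => (k == l)%:R * #|I|%:R + 1 + 1)) => [|l _].
    rewrite !big_split/= -mulr_suml S !sumr_const; ring.
  rewrite (eq_bigr (fun m => (k == l)%:R + (k == m)%:R + (l == m)%:R)) => [|m _].
    rewrite !big_split/= !S sumr_const -mulr_natr; ring.
  by rewrite !big_split/= -!mulr_sumr -mulr_suml !S !mulr1 mul1r.
apply: ler_sum => k _; apply: ler_sum => l _; apply: ler_sum => m _.
apply: ler_sum => o _; apply: le_trans (ler_norm _) _; exact: norm_Ex_Y4.
Qed.

End separated.

End bernoulli.

(** * Moments of the centered adjacency matrix *)

Section moments.
Context {R : realType} {n : nat} {E : finType}.
Variables (p : R) (ed : 'I_n -> 'I_n -> E).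
Hypothesis p01 : 0 < p <= 1.
(* [ed i j] is the coordinate carrying the unordered pair of [i] and [j]. *)
Hypothesis edE : forall i j k l,
  (ed i j == ed k l) = (i == k) && (j == l) || (i == l) && (j == k).

Notation Ex := (@Ex R E p).

Let ed_sym i j : ed i j = ed j i.
Proof. by apply/eqP; rewrite edE !eqxx orbT. Qed.

Let p01' : 0 <= p <= 1.
Proof. by case/andP: p01 => /ltW -> ->. Qed.

(** The matrix [H]: the adjacency matrix minus [p] in every entry. *)
Definition centered_mx (M : {ffun E -> bool}) : 'M[R]_n :=
  \matrix_(i, j) centered p (ed i j) M.

Local Notation X i j := (centered p (ed i j)).

Lemma norm_centered_mx M i j : `|centered_mx M i j| <= 1.
Proof. by rewrite mxE; exact: norm_centered. Qed.

Lemma tr_centered_mx M : (centered_mx M)^T = centered_mx M.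
Proof. by apply/matrixP => i j; rewrite !mxE ed_sym. Qed.

Lemma sum_delta k : \sum_(l < n) (k == l)%:R = 1 :> R.
Proof.
rewrite (bigD1 k)//= eqxx big1 ?addr0// => l; rewrite eq_sym => /negbTE.
by rewrite eq_sym => ->.
Qed.

Lemma sum_cst (c : R) : \sum_(k < n) c = n%:R * c.
Proof. by rewrite sumr_const card_ord mulr_natl. Qed.

Let delta (b c : bool) : (b -> c) -> b%:R <= c%:R :> R.
Proof. by case: b; case: c => // /(_ isT). Qed.

Lemma Ex_edge (e : E) : Ex (centered p e) = 0.
Proof.
rewrite -(@Ex_centered R E p e (fun=> 1)); last exact: ignores_cst.
by apply: eq_Ex => M; rewrite mulr1.
Qed.

Lemma Ex_edge2 (e f : E) :
  Ex (fun M => centered p e M * centered p f M) = (e == f)%:R * (p * (1 - p)).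
Proof.
have [->|ef] := eqVneq e f.
  by rewrite mul1r -(Ex_centered_sqr p f); apply: eq_Ex => M; rewrite expr2.
by rewrite mul0r Ex_centered//; exact: ignores_centered.
Qed.

Lemma norm_Ex_edge3 (e f g : E) :
  `|Ex (fun M => centered p e M * centered p f M * centered p g M)| <=
  ((e == f) && (f == g))%:R.
Proof.
have [c|] := boolP ((e == f) && (f == g)).
  apply: norm_Ex_le1 => // M; rewrite !normrM.
  by rewrite !mulr_ile1 ?mulr_ge0 ?norm_centered.
have iso a b c h : h =1 (fun M => centered p a M * (centered p b M * centered p c M)) ->
    a != b -> a != c -> Ex h = 0.
  move=> hE ab ac; rewrite (eq_Ex _ hE) Ex_centered//.
  by apply: ignoresM; exact: ignores_centered.
move=> c; suff -> : Ex (fun M => centered p e M * centered p f M * centered p g M) = 0.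
  by rewrite normr0.
have [ef|ef] := eqVneq e f; have [eg|eg] := eqVneq e g.
- by move: c; rewrite -ef eqxx eg eqxx.
- by apply: (iso g e f) => [M||]; [ring|rewrite eq_sym|rewrite -ef eq_sym].
- by apply: (iso f e g) => [M||]; [ring|rewrite eq_sym|rewrite -eg eq_sym].
- by apply: (iso e f g) => // M; ring.
Qed.

Lemma norm_Ex_edge4 (e f g h : E) :
  `|Ex (fun M => centered p e M * centered p f M * (centered p g M * centered p h M))| <=
  (e == f)%:R * (g == h)%:R + (e == g)%:R * (f == h)%:R + (e == h)%:R * (f == g)%:R.
Proof.
apply: (norm_Ex_Y4 p01' (eps := id) (Y := centered p) (Z := fun _ _ => 1)).
- by move=> k M; rewrite mulr1.
- by move=> k; exact: ignores_cst.
- by move=> k l lk; apply: ignores_centered; rewrite eq_sym.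
- by move=> k M; exact: norm_centered.
Qed.

Lemma degreesE M j : degrees (centered_mx M) 0 j = \sum_i X i j M.
Proof. by rewrite mxE; apply: eq_bigr => i _; rewrite !mxE mul1r. Qed.

Lemma totalE M : total (centered_mx M) = \sum_j \sum_i X i j M.
Proof. by apply: eq_bigr => j _; rewrite mxE mul1r degreesE. Qed.

Lemma walks2E M k : (degrees (centered_mx M) *m centered_mx M) 0 k =
  \sum_j \sum_i X i j M * X j k M.
Proof.
by rewrite mxE; apply: eq_bigr => j _; rewrite degreesE mxE mulr_suml.
Qed.

Lemma Ex_total : Ex (fun M => total (centered_mx M)) = 0.
Proof.
rewrite (eq_Ex _ totalE) Ex_sum big1// => j _; rewrite Ex_sum big1// => i _.
exact: Ex_edge.
Qed.

Lemma Ex_total2 : Ex (fun M => total (centered_mx M) ^+ 2) <= 2 * n%:R ^+ 2.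
Proof.
have -> : Ex (fun M => total (centered_mx M) ^+ 2) =
    \sum_j \sum_i \sum_l \sum_k Ex (fun M => X i j M * X k l M).
  rewrite (eq_Ex p (g := fun M => \sum_j \sum_i \sum_l \sum_k X i j M * X k l M)).
    rewrite Ex_sum; apply: eq_bigr => j _; rewrite Ex_sum; apply: eq_bigr => i _.
    by rewrite Ex_sum; apply: eq_bigr => l _; rewrite Ex_sum.
  move=> M; rewrite totalE expr2 mulr_suml; apply: eq_bigr => j _.
  rewrite mulr_suml; apply: eq_bigr => i _; rewrite mulr_sumr.
  by apply: eq_bigr => l _; rewrite mulr_sumr.
have -> : 2 * n%:R ^+ 2 = \sum_(j < n) \sum_(i < n) \sum_(l < n) \sum_(k < n)
    ((j == l)%:R * (i == k)%:R + (i == l)%:R * (j == k)%:R) :> R.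
  rewrite (eq_bigr (fun=> 2 * n%:R)) => [|j _].
    by rewrite sum_cst; ring.
  rewrite (eq_bigr (fun=> 2)) => [|i _].
    by rewrite sum_cst mulrC.
  rewrite (eq_bigr (fun l => (j == l)%:R + (i == l)%:R)) => [|l _].
    by rewrite big_split/= !sum_delta.
  by rewrite big_split/= -!mulr_sumr !sum_delta !mulr1.
do 4 (apply: ler_sum => ? _); rewrite Ex_edge2 edE.
set b1 := _ == _; set b2 := _ == _; set b3 := _ == _; set b4 := _ == _.
have q1 : p * (1 - p) <= 1 by case/andP: p01' => *; nra.
by case: b1; case: b2; case: b3; case: b4 => /=; lra.
Qed.

Lemma Ex_degrees_sqr :
  Ex (fun M => degrees_sqr (centered_mx M)) = n%:R ^+ 2 * (p * (1 - p)).
Proof.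
rewrite (eq_Ex p (g := fun M => \sum_j \sum_i \sum_k X i j M * X k j M)); last first.
  by move=> M; apply: eq_bigr => j _; rewrite !degreesE big_distrlr.
rewrite Ex_sum (eq_bigr (fun=> n%:R * (p * (1 - p)))) => [|j _].
  by rewrite sum_cst; ring.
rewrite Ex_sum (eq_bigr (fun=> p * (1 - p))) => [|i _].
  by rewrite sum_cst.
rewrite Ex_sum -[RHS]mul1r -{1}(sum_delta i) mulr_suml; apply: eq_bigr => k _.
rewrite Ex_edge2 edE eqxx andbT; congr (_%:R * _).
case: (i =P k) => //= ik; case: (i =P j) => //= ij; case: (j =P k) => //= jk.
by case: ik; rewrite ij.
Qed.

Lemma Ex_degrees4 j : Ex (fun M => degrees (centered_mx M) 0 j ^+ 4) <= 3 * n%:R ^+ 2.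
Proof.
rewrite -[n in leRHS]card_ord.
rewrite (eq_Ex p (g := fun M => (\sum_i X i j M) ^+ 4)); last first.
  by move=> M; rewrite degreesE.
apply: (Ex_sum4 p01' (eps := fun i => ed i j) (Z := fun _ _ => 1)).
- by move=> k M; rewrite mulr1.
- by move=> k; exact: ignores_cst.
- move=> k l lk; apply: ignores_centered; rewrite edE eqxx andbT eq_sym (negbTE lk)/=.
  by apply: contra lk => /andP[/eqP -> /eqP ->].
- by move=> k M; exact: norm_centered.
Qed.

Lemma Ex_degrees_sqr2 :
  Ex (fun M => degrees_sqr (centered_mx M) ^+ 2) <= 3 * n%:R ^+ 4.
Proof.
apply: (@le_trans _ _ (Ex (fun M => n%:R * \sum_j degrees (centered_mx M) 0 j ^+ 4))).
  apply: le_Ex => // M; apply: le_trans (sqr_sum_le _ _) _.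
  rewrite cardT size_enum_ord ler_wpM2l//; apply: ler_sum => j _.
  by rewrite -expr2 -exprM.
rewrite ExZ Ex_sum.
have -> : 3 * n%:R ^+ 4 = n%:R * \sum_(j < n) 3 * n%:R ^+ 2 :> R.
  by rewrite sum_cst; ring.
by rewrite ler_wpM2l//; apply: ler_sum => j _; exact: Ex_degrees4.
Qed.

(** Only the walks that traverse the same edge three times contribute. *)
Lemma norm_Ex_cubic_walks :
  `|Ex (fun M => cubic_walks (centered_mx M))| <= n%:R ^+ 2.
Proof.
rewrite (eq_Ex p (g := fun M => \sum_k \sum_l \sum_j \sum_i X l k M * X i j M * X j k M)).
  rewrite Ex_sum; have -> : n%:R ^+ 2 = \sum_(k < n) \sum_(l < n) \sum_(j < n) \sum_(i < n)
      ((i == k)%:R * (l == j)%:R) :> R.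
    rewrite (eq_bigr (fun=> n%:R)) => [|k _]; first by rewrite sum_cst -expr2.
    rewrite (eq_bigr (fun=> 1)) => [|l _]; first by rewrite sum_cst mulr1.
    rewrite -[RHS](sum_delta l); apply: eq_bigr => j _.
    rewrite -mulr_suml -[RHS]mul1r; congr (_ * _).
    by rewrite -[RHS](sum_delta k); apply: eq_bigr => i _; rewrite eq_sym.
  apply: le_trans (ler_norm_sum _ _ _) _; apply: ler_sum => k _.
  rewrite Ex_sum; apply: le_trans (ler_norm_sum _ _ _) _; apply: ler_sum => l _.
  rewrite Ex_sum; apply: le_trans (ler_norm_sum _ _ _) _; apply: ler_sum => j _.
  rewrite Ex_sum; apply: le_trans (ler_norm_sum _ _ _) _; apply: ler_sum => i _.
  apply: le_trans (norm_Ex_edge3 _ _ _) _; rewrite -natrM mulnb; apply: delta.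
  rewrite !edE => /andP[] /orP[] /andP[/eqP ? /eqP ?] /orP[] /andP[/eqP ? /eqP ?];
  by subst; rewrite !eqxx.
move=> M; rewrite /cubic_walks; apply: eq_bigr => k _.
rewrite degreesE walks2E mulr_suml; apply: eq_bigr => l _.
rewrite mulr_sumr; apply: eq_bigr => j _; rewrite mulr_sumr; apply: eq_bigr => i _.
by rewrite mulrA.
Qed.

(** Two walks of length 2 with the same endpoint [k] contribute only if their
    four edges can be paired off, which leaves four families with three free
    vertices. *)
Lemma Ex_walks2_sqr :
  Ex (fun M => walks2_sqr (centered_mx M)) <= 4 * n%:R ^+ 3.
Proof.
rewrite (eq_Ex p (g := fun M => \sum_k \sum_j \sum_i \sum_j' \sum_i'
    X i j M * X j k M * (X i' j' M * X j' k M))).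
  rewrite Ex_sum; have -> : 4 * n%:R ^+ 3 =
      \sum_(k < n) \sum_(j < n) \sum_(i < n) \sum_(j' < n) \sum_(i' < n)
      ((k == i)%:R * (k == i')%:R + (j == j')%:R * (i == i')%:R +
      ((i == j')%:R * (k == j)%:R + (k == i)%:R * (j == j')%:R)) :> R.
    pose c := n%:R : R; rewrite -/c.
    rewrite (eq_bigr (fun=> 4 * c ^+ 2)) => [|k _].
      by rewrite sum_cst -/c; ring.
    rewrite (eq_bigr (fun j => 3 * c + (k == j)%:R * c ^+ 2 * 1)) => [|j _].
      rewrite big_split/= -!mulr_suml sum_delta sum_cst.
      by rewrite -/c; ring.
    rewrite (eq_bigr (fun i => (k == i)%:R * c + 1 + ((k == j)%:R * c + (k == i)%:R * c))) => [|i _].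
      rewrite !big_split/= -!mulr_suml !sum_delta !sum_cst.
      by rewrite -/c; ring.
    rewrite (eq_bigr (fun j' => (k == i)%:R + (j == j')%:R +
        ((i == j')%:R * ((k == j)%:R * c) + (j == j')%:R * ((k == i)%:R * c)))) => [|j' _].
      rewrite !big_split/= -!mulr_suml !sum_delta !sum_cst.
      by rewrite -/c; ring.
    rewrite !big_split/= -!mulr_sumr !sum_delta !sum_cst.
    by rewrite -/c; ring.
  apply: ler_sum => k _; rewrite Ex_sum; apply: ler_sum => j _.
  rewrite Ex_sum; apply: ler_sum => i _; rewrite Ex_sum; apply: ler_sum => j' _.
  rewrite Ex_sum; apply: ler_sum => i' _.
  apply: le_trans (ler_norm _) _; apply: le_trans (norm_Ex_edge4 _ _ _ _) _.
  apply: lerD; first apply: lerD; rewrite -!natrM !mulnb.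
  - apply: delta; rewrite !edE.
    by move=> /andP[] /orP[] /andP[/eqP ? /eqP ?] /orP[] /andP[/eqP ? /eqP ?];
      subst; rewrite !eqxx.
  - apply: delta; rewrite !edE.
    by move=> /andP[] /orP[] /andP[/eqP ? /eqP ?] /orP[] /andP[/eqP ? /eqP ?];
      subst; rewrite !eqxx.
  - apply: (@le_trans _ _ (((i == j') && (k == j)) || ((k == i) && (j == j')))%:R).
      apply: delta; rewrite !edE.
      by move=> /andP[] /orP[] /andP[/eqP ? /eqP ?] /orP[] /andP[/eqP ? /eqP ?];
        subst; rewrite !eqxx ?orbT.
    by case: (_ && _); case: (_ && _); rewrite /= -?natrD ler_nat.
move=> M; rewrite /walks2_sqr; apply: eq_bigr => k _.
rewrite walks2E mulr_suml; apply: eq_bigr => j _.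
rewrite mulr_suml; apply: eq_bigr => i _; rewrite mulr_sumr; apply: eq_bigr => j' _.
by rewrite mulr_sumr.
Qed.

Lemma Ex_sqr_entry4 i j : i != j ->
  Ex (fun M => (centered_mx M *m centered_mx M) i j ^+ 4) <= 3 * n%:R ^+ 2.
Proof.
move=> ij; rewrite -[n in leRHS]card_ord.
rewrite (eq_Ex p (g := fun M => (\sum_k X i k M * X k j M) ^+ 4)); last first.
  by move=> M; rewrite mxE; congr (_ ^+ _); apply: eq_bigr => k _; rewrite !mxE.
(* The edge [i k] is private to the term [k], except for [k = j], where it equals
   the second factor of the term [i]; the loop at [j] serves instead. *)
apply: (Ex_sum4 p01' (eps := fun k => if k == j then ed k j else ed i k)
  (Z := fun k => if k == j then X i k else X k j)).
- by move=> k M; case: eqP => _ //; rewrite mulrC.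
- move=> k; have [->|kj] := eqVneq k j; apply: ignores_centered; rewrite edE.
    by rewrite eqxx andbT [j == i]eq_sym (negbTE ij).
  by rewrite (negbTE ij) (negbTE kj) andbF.
- move=> k l lk; have [kj|kj] := eqVneq k j; apply: ignoresM;
    apply: ignores_centered; rewrite edE.
  + by rewrite kj [j == i]eq_sym (negbTE ij) andbF.
  + by rewrite -kj [k == l]eq_sym (negbTE lk) andbF.
  + rewrite eqxx/= [k == l]eq_sym (negbTE lk)/=.
    by apply: contra lk => /andP[/eqP <- /eqP ->].
  + by rewrite (negbTE ij)/= (negbTE kj) andbF.
- move=> k M; rewrite normrM mulr_ile1// norm_centered//.
Qed.

Lemma Ex_offdiag_sqr2 :
  Ex (fun M => offdiag_sqr (centered_mx M) ^+ 2) <= 3 * n%:R ^+ 6.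
Proof.
set P := fun e : 'I_n * 'I_n => e.1 != e.2.
have cP : (#|P|%:R : R) <= n%:R ^+ 2.
  rewrite -natrX ler_nat; apply: leq_trans (max_card _) _.
  by rewrite card_prod card_ord.
apply: (@le_trans _ _ (Ex (fun M => n%:R ^+ 2 *
    \sum_(e | P e) (centered_mx M *m centered_mx M) e.1 e.2 ^+ 4))).
  apply: le_Ex => // M; apply: le_trans (sqr_sum_le _ _) _.
  apply: ler_pM => //; first by apply: sumr_ge0 => e _; exact: sqr_ge0.
  by apply: ler_sum => j _; rewrite -exprM.
rewrite ExZ Ex_sum.
apply: (@le_trans _ _ (n%:R ^+ 2 * \sum_(e | P e) 3 * n%:R ^+ 2)).
  rewrite ler_wpM2l ?exprn_ge0//; apply: ler_sum => e Pe; exact: Ex_sqr_entry4.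
rewrite sumr_const -(mulr_natr (3 * _)).
have -> : 3 * n%:R ^+ 6 = n%:R ^+ 2 * (3 * n%:R ^+ 2 * n%:R ^+ 2) :> R by ring.
by rewrite !ler_wpM2l ?mulr_ge0 ?exprn_ge0.
Qed.

End moments.

(** * Expectation of the principal eigenvalue *)

(** Sum of the constants in front of the individual contributions to the error. *)
Definition expansion_constant {R : pzRingType} : R :=
  26 + 81 + 20 + 5 * 32 ^+ 4 * 3 + 5 * 32 ^+ 2 + 1.

(** All powers of [1 / p] are bounded by the largest one, so that the bound is
    decreasing in [p]. *)
Lemma Ex_principal_eigenvalue (R : realType) (n : nat) (E : finType)
    (ed : 'I_n -> 'I_n -> E) (p : R) : (0 < n)%N -> 0 < p <= 1 ->
    (forall i j k l,
      (ed i j == ed k l) = (i == k) && (j == l) || (i == l) && (j == k)) ->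
  `|Ex p (fun M => principal_eigenvalue (\matrix_(i, j) (M (ed i j))%:R)) -
    (n%:R * p + (1 - p))| <= expansion_constant / p ^+ 10 / n%:R.
Proof.
move=> n0 p01 edE; have /andP[p0 p1] := p01.
have p01' : 0 <= p <= 1 by rewrite ltW.
have N0 : 0 < n%:R :> R by rewrite ltr0n.
pose H := centered_mx p ed; pose m := n%:R * p.
have m0 : 0 < m by rewrite mulr_gt0.
pose mu (M : {ffun E -> bool}) : R := principal_eigenvalue (\matrix_(i, j) (M (ed i j))%:R).
pose S M := p * (total (H M) / m + degrees_sqr (H M) / m ^+ 2 + cubic_walks (H M) / m ^+ 3).
pose err M := 13 * total (H M) ^+ 2 / m ^+ 3 + 27 * degrees_sqr (H M) ^+ 2 / m ^+ 5 +
  5 * walks2_sqr (H M) / m ^+ 4 +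
  (5 * 32 ^+ 4 / p ^+ 10) * (offdiag_sqr (H M) ^+ 2 / n%:R ^+ 7) +
  (5 * 32 ^+ 2 / p ^+ 6) / n%:R.
have est M : `|mu M - m - S M| <= err M.
  have -> : mu M = principal_eigenvalue (const_mx p + H M).
    congr principal_eigenvalue; apply/matrixP => i j.
    by rewrite !mxE /centered addrC subrK.
  apply: principal_eigenvalue_estimate => //.
  - exact: tr_centered_mx.
  - by move=> i j; exact: norm_centered_mx.
  - move=> i j; rewrite mxE /centered addrC subrK.
    by case: (M _); rewrite ?normr1 ?normr0.
have ExS : Ex p S = 1 - p + p / m ^+ 3 * Ex p (fun M => cubic_walks (H M)).
  rewrite /S ExZ !ExD.
  have Z f k : Ex p (fun M => f M / k) = Ex p f / k.
    by rewrite mulrC -ExZ; apply: eq_Ex => M; rewrite mulrC.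
  rewrite !Z Ex_total (Ex_degrees_sqr p edE) /m.
  by field; rewrite !gt_eqF.
have ExErr : Ex p err <= (26 / p ^+ 3 + 81 / p ^+ 5 + 20 / p ^+ 4 +
    5 * 32 ^+ 4 * 3 / p ^+ 10 + 5 * 32 ^+ 2 / p ^+ 6) / n%:R.
  have -> : Ex p err = 13 * Ex p (fun M => total (H M) ^+ 2) / m ^+ 3 +
      27 * Ex p (fun M => degrees_sqr (H M) ^+ 2) / m ^+ 5 +
      5 * Ex p (fun M => walks2_sqr (H M)) / m ^+ 4 +
      (5 * 32 ^+ 4 / p ^+ 10) * (Ex p (fun M => offdiag_sqr (H M) ^+ 2) / n%:R ^+ 7) +
      (5 * 32 ^+ 2 / p ^+ 6) / n%:R.
    have E5 f1 f2 f3 f4 (c1 k1 c2 k2 c3 k3 c4 k4 c5 : R) :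
        Ex p (fun M : {ffun E -> bool} => c1 * f1 M / k1 + c2 * f2 M / k2 +
          c3 * f3 M / k3 + c4 * (f4 M / k4) + c5) =
        c1 * Ex p f1 / k1 + c2 * Ex p f2 / k2 + c3 * Ex p f3 / k3 +
          c4 * (Ex p f4 / k4) + c5.
      rewrite !ExD Ex_cst; congr (_ + _ + _ + _ + _).
      - by rewrite mulrAC -ExZ; apply: eq_Ex => M; rewrite mulrAC.
      - by rewrite mulrAC -ExZ; apply: eq_Ex => M; rewrite mulrAC.
      - by rewrite mulrAC -ExZ; apply: eq_Ex => M; rewrite mulrAC.
      - by rewrite mulrA mulrAC -ExZ; apply: eq_Ex => M; rewrite mulrA mulrAC.
    exact: E5.
  have D5 (a b c d e x : R) : (a + b + c + d + e) * x = a * x + b * x + c * x + d * x + e * x.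
    by ring.
  rewrite D5.
  have X (f : {ffun E -> bool} -> R) (b c c' k : R) :
      0 < k -> 0 <= c -> Ex p f <= b -> c * b / k = c' -> c * Ex p f / k <= c'.
    move=> k0 c0 fb <-; rewrite ler_pM2r ?invr_gt0//; exact: ler_wpM2l.
  apply: lerD => //; apply: lerD; first apply: lerD; first apply: lerD.
  - apply: (X _ _ _ _ _ _ _ (Ex_total2 p01 edE)); rewrite ?exprn_gt0// /m.
    by field; rewrite !gt_eqF.
  - apply: (X _ _ _ _ _ _ _ (Ex_degrees_sqr2 p01 edE)); rewrite ?exprn_gt0// /m.
    by field; rewrite !gt_eqF.
  - apply: (X _ _ _ _ _ _ _ (Ex_walks2_sqr p01 edE)); rewrite ?exprn_gt0// /m.
    by field; rewrite !gt_eqF.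
  - rewrite mulrA; apply: (X _ _ _ _ _ _ _ (Ex_offdiag_sqr2 p01 edE)); rewrite ?exprn_gt0//.
      by rewrite divr_ge0 ?exprn_ge0 ?mulr_ge0 ?exprn_ge0 ?(ltW p0).
    by field; rewrite !gt_eqF.
have ExC : `|p / m ^+ 3 * Ex p (fun M => cubic_walks (H M))| <= 1 / p ^+ 2 / n%:R.
  have k0 : 0 <= p / m ^+ 3 by rewrite divr_ge0 ?exprn_ge0 ?(ltW p0) ?(ltW m0).
  rewrite normrM (ger0_norm k0).
  apply: (@le_trans _ _ (p / m ^+ 3 * n%:R ^+ 2)).
    by rewrite ler_wpM2l//; exact: norm_Ex_cubic_walks.
  by rewrite le_eqVlt; apply/orP; left; apply/eqP; rewrite /m; field; rewrite !gt_eqF.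
have main : `|Ex p mu - m - Ex p S| <= Ex p err.
  rewrite -(Ex_cst (E := E) p m) -!ExB.
  by apply: le_trans (norm_Ex p01' _) _; apply: le_Ex.
have q1 k : (k <= 10)%N -> (p ^+ k)^-1 <= (p ^+ 10)^-1.
  move=> k10; rewrite lef_pV2 ?posrE ?exprn_gt0//.
  by apply: ler_wiXn2l => //; exact: ltW.
apply: (@le_trans _ _ ((26 / p ^+ 3 + 81 / p ^+ 5 + 20 / p ^+ 4 +
    5 * 32 ^+ 4 * 3 / p ^+ 10 + 5 * 32 ^+ 2 / p ^+ 6 + 1 / p ^+ 2) / n%:R)); last first.
  rewrite ler_pM2r ?invr_gt0// /expansion_constant.
  have a3 := q1 3%N isT; have a5 := q1 5%N isT; have a4 := q1 4%N isT.
  have a6 := q1 6%N isT; have a2 := q1 2%N isT.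
  lra.
have D2 (a b x : R) : (a + b) * x = a * x + b * x by rewrite mulrDl.
rewrite [leRHS]D2.
have -> : Ex p mu - (n%:R * p + (1 - p)) = (Ex p mu - m - Ex p S) +
    p / m ^+ 3 * Ex p (fun M => cubic_walks (H M)).
  by rewrite ExS -/m; ring.
apply: le_trans (ler_normD _ _) _; apply: lerD ExC.
exact: le_trans main ExErr.
Qed.

(** * The dynamic random graph at a fixed time *)

Section edges.
Context {R : realType} {d : measure_display} {Omega : measurableType d}.
Variable P : probability Omega R.

Lemma measurable_bool_event (f : Omega -> bool) (b : bool) :
  measurable_fun setT f -> measurable [set w | f w = b].
Proof.
move=> mf; have -> : [set w | f w = b] = setT `&` f @^-1` [set b].
  by rewrite setTI.
by apply: mf.
Qed.

(** An edge present at time 0 whose first sojourn exceeds [T] is still present at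
    time [t]. *)
Lemma edge_prob_ge (T p0 lon loff t : R) (X : R -> Omega -> bool) :
    0 < T -> 0 < lon -> (forall s, s \in `[0, T] -> measurable_fun setT (X s)) ->
    alternating_process P T p0 lon loff X -> t \in `[0, T] ->
  p0 * expR (- lon * T) <= edge_prob P X t.
Proof.
move=> T0 lon0 mX [X0 [S [Sexp Sind [N [mN PN0 NQ]]]]] tT.
pose B := [set w | X 0 w = true].
pose C := S true 0%N @^-1` (~` `[0, T]).
(* A sojourn time outside [0, T] exceeds [T], up to the null event [D]. *)
pose D := S true 0%N @^-1` [set x : R | x < 0].
have mB : measurable B.
  by apply: measurable_bool_event; apply: mX; rewrite in_itv/= lexx ltW.
have mSp (A : set R) : measurable A -> measurable (S true 0%N @^-1` A).
  by move=> mA; rewrite -[X in measurable X]setTI; exact: measurable_funP.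
have mlt0 : measurable [set x : R | x < 0].
  rewrite (_ : [set x | _] = [set` `]-oo, 0[]); first exact: measurable_itv.
  by apply/seteqP; split => x /=; rewrite in_itv.
have PC : P C = (expR (- lon * T))%:E.
  have -> : P C = distribution P (S true 0%N) (~` `[0, T]) by [].
  rewrite probability_setC; last exact: measurable_itv.
  transitivity (1 - exponential_prob lon `[0%R, T])%E.
    by congr (1 - _)%E; apply: (Sexp true 0%N); exact: measurable_itv.
  by rewrite exponential_prob_itv0c// -!EFinB; congr EFin; ring.
have PD : P D = 0%E.
  have -> : P D = distribution P (S true 0%N) [set x : R | x < 0] by [].
  rewrite (Sexp true 0%N _ mlt0) /exponential_prob integral0_eq// => x /= x0.
  by rewrite lt0_exponential_pdf.
have PBC : P (B `&` C) = (p0 * expR (- lon * T))%:E.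
  have := Sind [fset None; Some (true, 0%N)]%fset
    (fun i => if i is None then B else C).
  rewrite big_fsetU1/=; last by rewrite inE.
  rewrite big_seq_fset1 PC (_ : P B = p0%:E)// EFinM => <- //.
    congr (P _); apply/seteqP; split => w /=.
      by move=> [Bw Cw] [i|] _.
    by move=> H; split; [apply: (H None)|apply: (H (Some (true, 0%N)))];
      rewrite /= !inE ?eqxx ?orbT.
  move=> i; rewrite !inE => /orP[] /eqP ->.
    by exists [set true] => //; rewrite setTI.
  exists (~` `[0, T]); last by rewrite setTI.
  by apply: measurableC; exact: measurable_itv.
have mXt : measurable [set w | X t w = true].
  by apply: measurable_bool_event; exact: mX.
have sub : B `&` C `<=` [set w | X t w = true] `|` (D `|` N).
  move=> w [Bw Cw]; have [Nw|Nw] := pselect (N w); first by right; right.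
  have [s0|s0] := ltP (S true 0%N w) 0; first by right; left.
  left; have Q : forall (n : nat) (t : R), t \in `[0, T] ->
      jump_time (X 0 w) (fun c k => S c k w) n <= t <
      jump_time (X 0 w) (fun c k => S c k w) n.+1 ->
      X t w = sojourn_state (X 0 w) n.
    by apply: contrapT => nQ; apply: Nw; apply: NQ.
  rewrite /= (Q 0%N)//; first by rewrite Bw.
  move: tT; rewrite in_itv/= => /andP[t0 tT].
  rewrite /jump_time big_ord0 t0/= big_ord_recl big_ord0 addr0/= Bw.
  apply: (le_lt_trans tT); rewrite ltNge; apply/negP => sT.
  by apply: Cw; rewrite /= in_itv/= s0.
rewrite -lee_fin /edge_prob fineK; last by rewrite fin_num_measure.
rewrite -PBC; apply: (@le_trans _ _ (P ([set w | X t w = true] `|` (D `|` N)))).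
  apply: le_measure sub; rewrite inE; first apply: measurableI => //.
    exact: mSp (measurableC (measurable_itv _)).
  by apply: measurableU => //; apply: measurableU => //; exact: mSp.
apply: le_trans (measureU2 _ _ _) _ => //; first by apply: measurableU => //; exact: mSp.
rewrite -[leRHS]adde0 leeD2l//.
apply: le_trans (measureU2 _ _ _) _ => //; first exact: mSp.
by rewrite -[leRHS]adde0 leeD// ?[leLHS]PD ?[leLHS]PN0.
Qed.

(** The expectation of a function of a random element of a finite type. *)
Lemma expectation_finType (F : finType) (G : Omega -> F) (phi : F -> R) :
    (forall M, measurable [set w | G w = M]) ->
  ('E_P[fun w => phi (G w)] = \sum_M (phi M)%:E * P [set w | G w = M])%E.
Proof.
move=> mG; rewrite unlock.
rewrite (eq_integral (fun w => \sum_M (phi M)%:E * (\1_[set w | G w = M] w)%:E)%E); last first.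
  move=> w _; rewrite (bigD1 (G w))//= big1 => [|M MG].
    by rewrite indicE mem_set// mule1 adde0.
  by rewrite indicE memNset ?mule0//= => GM; rewrite GM eqxx in MG.
rewrite integral_sum//; last by move=> M; apply: integrableZl => //; exact: integrable_indic.
apply: eq_bigr => M _; rewrite integralZl//; last exact: integrable_indic.
by rewrite integral_indic// setIT.
Qed.

End edges.

(** Unordered pairs of vertices, loops included. *)
Definition edge (N : nat) := {e : 'I_N * 'I_N | (e.1 <= e.2)%N}.

Lemma edge_of_subproof N (i j : 'I_N) :
  ((if (i <= j)%N then (i, j) else (j, i)).1 <=
   (if (i <= j)%N then (i, j) else (j, i)).2)%N.
Proof. by case: (leqP i j) => [|/ltnW]. Qed.

(** The unordered pair of [i] and [j], represented in increasing order. *)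
Definition edge_of N (i j : 'I_N) : edge N :=
  exist _ (if (i <= j)%N then (i, j) else (j, i)) (edge_of_subproof i j).

Lemma eq_edge_of N (i j k l : 'I_N) :
  (edge_of i j == edge_of k l) = (i == k) && (j == l) || (i == l) && (j == k).
Proof.
rewrite -val_eqE/=; case: (leqP i j) => ij; case: (leqP k l) => kl; rewrite xpair_eqE.
all: apply/idP/idP.
all: rewrite -!val_eqE /=; lia.
Qed.

Section graph.
Context {R : realType} {d : measure_display} {Omega : measurableType d}.
Variables (P : probability Omega R) (T p0 lon loff : R) (N : nat).
Variable a : 'I_N -> 'I_N -> R -> Omega -> bool.
Hypothesis aER : dynamic_ER P T p0 lon loff a.

(** The state of all edges at time [t]. *)
Definition snapshot t w : {ffun edge N -> bool} :=
  [ffun e => a (val e).1 (val e).2 t w].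

Lemma adjacencyE t w :
  adjacency a t w = \matrix_(i, j) (snapshot t w (edge_of i j))%:R :> 'M[R]_N.
Proof.
apply/matrixP => i j; rewrite !mxE ffunE/=; case: leqP => //= _.
by rewrite (ER_sym aER).
Qed.

Lemma eq_edge_prob i j k l t : t \in `[0, T] ->
  edge_prob P (a i j) t = edge_prob P (a k l) t.
Proof.
move=> tT; have := @ER_identically_distributed _ _ _ _ _ _ _ _ _ _ aER i j k l 1%N
  (fun=> t) (fun=> true) (fun=> tT).
have E (X : R -> Omega -> bool) : [set w | forall k : 'I_1, X t w = true] = [set w | X t w].
  by apply/seteqP; split => w /= => [/(_ ord0)|].
by rewrite !E /edge_prob => ->.
Qed.

Lemma measurable_snapshot t M : t \in `[0, T] -> measurable [set w | snapshot t w = M].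
Proof.
move=> tT.
have -> : [set w | snapshot t w = M] =
    \bigcap_(e in [set: edge N]) [set w | a (val e).1 (val e).2 t w = M e].
  apply/seteqP; split => w /=; first by move=> <- e _; rewrite /= ffunE.
  by move=> H; apply/ffunP => e; rewrite ffunE; exact: H.
apply: fin_bigcap_measurable => [|e _]; first exact: finite_finset.
by apply: measurable_bool_event; exact: (ER_measurable aER).
Qed.

(** The law of the snapshot is a product of Bernoulli laws; any edge may serve to
    express the parameter. *)
Lemma prob_snapshot i j t M : t \in `[0, T] ->
  P [set w | snapshot t w = M] = (weight (edge_prob P (a i j) t) M)%:E.
Proof.
move=> tT; set p := edge_prob _ _ _.
(* Independence is indexed by ordered pairs, so [M] is extended to all of them;
   the value [true] outside the increasing pairs is never used. *)
pose A (e : 'I_N * 'I_N) := [set w | a e.1 e.2 t w =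
  if insub e is Some e' then M e' else true].
have PA b k l : P [set w | a k l t w = b] = (bern p b)%:E.
  have mkl : measurable [set w | a k l t w = true].
    by apply: measurable_bool_event; exact: (ER_measurable aER).
  have Pt : P [set w | a k l t w = true] = p%:E.
    by rewrite /p (eq_edge_prob i j k l tT) /edge_prob fineK// fin_num_measure.
  case: b => //=; rewrite (_ : [set w | _] = ~` [set w | a k l t w = true]).
    by rewrite probability_setC// Pt.
  by apply/seteqP; split => w /=; case: (a k l t w).
have := @ER_independent _ _ _ _ _ _ _ _ _ _ aER [fset val e | e : edge N]%fset A.
have -> : \bigcap_(e in [set` [fset val e | e : edge N]%fset]) A e =
    [set w | snapshot t w = M].
  apply/seteqP; split => w /=.
    move=> H; apply/ffunP => e; rewrite ffunE.
    have /H : val e \in [fset val e | e : edge N]%fset by apply/imfsetP; exists e.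
    by rewrite /A/= valK.
  move=> GM e /imfsetP[/= e' _ ->].
  by rewrite /A/= valK -GM ffunE.
move=> ->.
- rewrite big_imfset/=; last by move=> ? ? _ _; exact: val_inj.
  rewrite /weight -prodEFin big_enum/=; apply: eq_bigr => e _.
  by rewrite /A valK PA.
- by move=> e /= /imfsetP[/= e' _ ->]; case: e'.
- move=> e /imfsetP[/= e' _ ->]; apply: sub_sigma_algebra; exists t => //.
  exists [set if insub (val e') is Some e'' then M e'' else true] => //.
  by rewrite setTI.
Qed.

Lemma expectation_principal_eigenvalue i j t : t \in `[0, T] ->
  ('E_P[fun w => principal_eigenvalue (adjacency a t w)] =
   (Ex (edge_prob P (a i j) t) (fun M : {ffun edge N -> bool} =>
     principal_eigenvalue (\matrix_(i, j) (M (edge_of i j))%:R)))%:E)%E.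
Proof.
move=> tT.
pose phi (M : {ffun edge N -> bool}) : R :=
  principal_eigenvalue (\matrix_(i, j) (M (edge_of i j))%:R).
have -> : (fun w => principal_eigenvalue (adjacency a t w)) = fun w => phi (snapshot t w).
  by apply/funext => w; rewrite adjacencyE.
rewrite expectation_finType; last by move=> M; exact: measurable_snapshot.
rewrite /Ex -sumEFin; apply: eq_bigr => M _.
by rewrite (prob_snapshot i j _ tT) -EFinM mulrC.
Qed.

End graph.

(** * Uniform expansion *)

Lemma limn_esup_fin_num (R : realType) (u : nat -> \bar R) (C : R) :
  (forall n, (0%:E <= u n <= C%:E)%E) -> limn_esup u \is a fin_num.
Proof.
move=> uC; rewrite fin_numElt; apply/andP; split.
  apply: (@lt_le_trans _ _ 0%:E); first exact: ltNyr.
  apply: le_ereal_inf_tmp => _ [V V_oo <-].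
  have [k Vk] := filter_ex V_oo.
  apply: (@le_trans _ _ (u k)); first by case/andP: (uC k).
  by apply: ereal_sup_ubound; exists k.
apply: (@le_lt_trans _ _ C%:E); last exact: ltry.
apply: (@le_trans _ _ (ereal_sup (u @` setT))).
  by apply: ereal_inf_lbound; exists setT => //; exact: filterT.
by apply: ge_ereal_sup => _ [k _ <-]; case/andP: (uC k).
Qed.

Theorem theorem3p4 (R : realType) (T p0 lon loff : R)
    (T_gt0 : 0 < T) (p0_01 : 0 < p0 < 1) (lon_gt0 : 0 < lon)
    (loff_gt0 : 0 < loff)
    (d : nat -> measure_display) (Omega : forall N, measurableType (d N))
    (P : forall N, probability (Omega N) R)
    (a : forall N, 'I_N -> 'I_N -> R -> Omega N -> bool)
    (a_ER : forall N, dynamic_ER (P N) T p0 lon loff (@a N)) :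
  exists G : nat -> R -> R,
    (forall (N : nat) (i j : 'I_N) (t : R), t \in `[0, T] ->
       let p := edge_prob (P N) (@a N i j) t in
       'E_(P N)[fun w => principal_eigenvalue (adjacency (@a N) t w)]%E =
         (N%:R * p + (1 - p) + G N t / N%:R)%:E) /\
    limn_esup (fun N => ereal_sup [set `|G N t|%:E | t in `[0, T]])
      \is a fin_num.
Proof.
pose E N t := fine 'E_(P N)[fun w => principal_eigenvalue (adjacency (@a N) t w)]%E.
(* The required identity determines [G]; without vertices it requires nothing. *)
pose G N t := if [pick i : 'I_N] is Some i then
    let p := edge_prob (P N) (@a N i i) t in
    N%:R * (E N t - (N%:R * p + (1 - p)))
  else 0.
exists G; split.
  move=> N i j t tT p.
  have EE := expectation_principal_eigenvalue (a_ER N) i j tT.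
  rewrite -/p in EE.
  have EEf : E N t = Ex p (fun M : {ffun edge N -> bool} =>
    principal_eigenvalue (\matrix_(i, j) (M (edge_of i j))%:R)) by rewrite /E EE.
  have N0 : N%:R != 0 :> R by rewrite pnatr_eq0 -lt0n (leq_ltn_trans _ (ltn_ord i)).
  rewrite /G; case: pickP => [k _|/(_ i)//].
  by rewrite EE (eq_edge_prob (a_ER N) k k i j tT) -/p EEf; congr EFin; field.
case/andP: p0_01 => p0_gt0 p0_lt1.
pose ps := p0 * expR (- lon * T).
have ps0 : 0 < ps by rewrite mulr_gt0 ?expR_gt0.
have GC N t : t \in `[0, T] -> `|G N t| <= expansion_constant / ps ^+ 10.
  move=> tT; rewrite /G; case: pickP => [i _|_]; last first.
    by rewrite normr0 divr_ge0 ?exprn_ge0 ?(ltW ps0)// /expansion_constant; lra.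
  move=> /=; set p := edge_prob _ _ _.
  have N0 : (0 < N)%N by rewrite (leq_ltn_trans _ (ltn_ord i)).
  have ps_p : ps <= p.
    apply: edge_prob_ge T_gt0 lon_gt0 _ (ER_alternating (a_ER N) i i) tT.
    by move=> s sT; exact: (ER_measurable (a_ER N)).
  have p_gt0 : 0 < p by exact: lt_le_trans ps_p.
  have p1 : p <= 1.
    have mE : measurable [set w | a N i i t w = true].
      by apply: measurable_bool_event; exact: (ER_measurable (a_ER N)).
    by rewrite -lee_fin fineK ?fin_num_measure// probability_le1.
  have -> : E N t = Ex p (fun M : {ffun edge N -> bool} =>
      principal_eigenvalue (\matrix_(i, j) (M (edge_of i j))%:R)).
    by rewrite /E (expectation_principal_eigenvalue (a_ER N) i i tT).
  rewrite normrM ger0_norm// -ler_pdivlMl ?ltr0n// [leRHS]mulrC.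
  apply: le_trans (Ex_principal_eigenvalue N0 _ (@eq_edge_of N)) _.
    by rewrite p_gt0.
  rewrite ler_pM2r ?invr_gt0 ?ltr0n// ler_wpM2l//.
    by rewrite /expansion_constant; lra.
  rewrite lef_pV2 ?posrE ?exprn_gt0//.
  by rewrite ler_pXn2r ?nnegrE ?(ltW ps0) ?(ltW p_gt0).
apply: (@limn_esup_fin_num _ _ (expansion_constant / ps ^+ 10)) => N.
apply/andP; split; last first.
  by apply: ge_ereal_sup => _ [t tT <-]; rewrite lee_fin GC.
apply: (@le_trans _ _ `|G N 0|%:E); first by rewrite lee_fin.
apply: ereal_sup_ubound; exists 0 => //=.
by rewrite in_itv/= lexx ltW.
Qed.
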